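(* Let $\dim V=2n\ge 4$ and fix $J\in\mathcal{T}(V,g)$. Let $QS\in\Gamma(\mathfrak{gl}(\mathbb{V}))$ be such that $Q=a_{k}\{J,\phi\}^{k}+\dots+a_{1}\{J,\phi\}+a_{0}\mathbb{1}$ with $a_{i}\in C^{\infty}(\mathcal{T})$, and $S\in\{\mathbb{1},\,J+\phi,\,J-\phi,\,[J,\phi]\}$. Moreover, suppose $a_{i}\in\mathbb{R}[f_{1},\dots,f_{2n}]$ for every $i$, where the $f_{j}\in C^{\infty}(\mathcal{T})$ are defined via $$\det(\lambda\mathbb{1}-\{J,\phi\})=\lambda^{2n}-f_{1}\lambda^{2n-1}+\dots-f_{2n-1}\lambda+f_{2n}.$$ For $K\in\mathcal{T}(V,g)$, consider the orthogonal and $J,K$-invariant splitting $V=\mathrm{Ker}QS|_{K}\oplus\mathrm{Im}QS|_{K}$ with the associated splittings $K=K^{a}\oplus K^{b}$, $J=J^{a}\oplus J^{b}$, and define $$\mathcal{T}^{QS}_{U(J),K}=\{K'=K^{a}\oplus K'^{b} \ |\ K'^{b}\in U(J^{b})\cdot K^{b}\}.$$ Then $\mathcal{T}^{QS}_{U(J),K}$ is the leaf that is associated to the integrable distribution $\mathcal{D}^{QS}_{\mathfrak{u}(J)}$ and that passes through $K$.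
   Context: $(V,g)$ is a $2n$-dimensional real vector space with a positive definite metric. $\mathcal{T}=\mathcal{T}(V,g)=\{K\in \mathrm{End}V : K^{2}=-1,\ g(K\cdot,K\cdot)=g(\cdot,\cdot)\}$, a submanifold of $\mathrm{End}V$. For a subspace $W\subset V$, $\mathcal{T}(W)$ denotes $\mathcal{T}(W,g|_W)$; $U(J^{b})$ is the group of orthogonal transformations of $\mathrm{Im}QS|_K$ commuting with $J^{b}$, and $U(J^{b})\cdot K^{b}$ is the orbit of $K^{b}$ under its conjugation action $A\cdot L=ALA^{-1}$ on $\mathcal{T}(\mathrm{Im}QS|_{K})$. $\mathbb{V}=V\times\mathcal{T}$, $\mathfrak{gl}(\mathbb{V})=\mathrm{End}V\times\mathcal{T}$. $\phi$ is the section with $\phi|_K=K$; $J$ and $\mathbb{1}$ are regarded as constant sections. $[A,B]=AB-BA$, $\{A,B\}=AB+BA$. $\mathfrak{o}_{\{\phi\}}$ is the bundle over $\mathcal{T}$ with fiber $\{A\in\mathfrak{o}(V,g):AK+KA=0\}$ at $K$; it is identified with $T\mathcal{T}$. $\mathfrak{u}(V,J)=\{A\in\mathfrak{o}(V,g):[A,J]=0\}$. The distribution $\mathcal{D}^{QS}_{\mathfrak{u}(J)}$ is defined pointwise on $\mathcal{T}$ by $$\mathcal{D}^{QS}_{\mathfrak{u}(J)}=\{[C,\phi]\in\mathfrak{o}_{\{\phi\}} \ |\ C\in\mathfrak{u}(V,J),\ C:\mathrm{Ker}QS\to 0,\ \mathrm{Im}QS\to\mathrm{Im}QS\}.$$ Distributions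 may have varying rank; the leaf through $K$ is the maximal connected integral submanifold through $K$, i.e. its tangent space at each point is the distribution at that point. *)

(* Defs.v *)
From HB Require Import structures.
From mathcomp Require Import all_boot all_order all_algebra.
From mathcomp Require Import all_classical all_reals all_analysis.
(* Required but not imported: the notations of [mpoly] clash with those of
   mathcomp-analysis. *)
From mathcomp Require mpoly.

Set Implicit Arguments.
Unset Strict Implicit.
Unset Printing Implicit Defensive.
Import Order.TTheory GRing.Theory Num.Theory.
Import numFieldNormedType.Exports.
Local Open Scope classical_set_scope.
Local Open Scope ring_scope.

(* A real vector space of dimension m is 'cV[R]_m, on which the endomorphisms
   'M[R]_m act by A *m v.  The metric is given by its Gram matrix G, which is
   an arbitrary symmetric positive definite matrix. *)
Definition metric (R : realType) (m : nat) (G : 'M[R]_m)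
    (u v : 'cV[R]_m) : R := (u^T *m G *m v) ord0 ord0.

Definition is_metric (R : realType) (m : nat) (G : 'M[R]_m) : Prop :=
  G^T = G /\ forall v : 'cV[R]_m, v != 0 -> 0 < metric G v v.

Definition comm (R : realType) (m : nat) (A B : 'M[R]_m) : 'M[R]_m :=
  A *m B - B *m A.

Definition acomm (R : realType) (m : nat) (A B : 'M[R]_m) : 'M[R]_m :=
  A *m B + B *m A.

Definition twistor (R : realType) (m : nat) (G : 'M[R]_m) : set 'M[R]_m :=
  [set K | K *m K = - 1%:M /\
           forall u v, metric G (K *m u) (K *m v) = metric G u v].

Definition so_alg (R : realType) (m : nat) (G : 'M[R]_m) : set 'M[R]_m :=
  [set A | forall u v, metric G (A *m u) v + metric G u (A *m v) = 0].

Definition u_alg (R : realType) (m : nat) (G J : 'M[R]_m) : set 'M[R]_m :=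
  [set A | so_alg G A /\ comm A J = 0].

(* The fibre of o_{phi} at K, which is the tangent space of the twistor space
   at K. *)
Definition so_anti (R : realType) (m : nat) (G K : 'M[R]_m) : set 'M[R]_m :=
  [set A | so_alg G A /\ acomm A K = 0].

Definition ker_space (R : realType) (m : nat) (P : 'M[R]_m) : set 'cV[R]_m :=
  [set v | P *m v = 0].

Definition im_space (R : realType) (m : nat) (P : 'M[R]_m) : set 'cV[R]_m :=
  [set P *m v | v in [set: 'cV[R]_m]].

Definition stable (R : realType) (m : nat) (A : 'M[R]_m)
    (W : set 'cV[R]_m) : Prop := forall w, W w -> W (A *m w).

Definition orthogonal_splitting (R : realType) (m : nat) (G : 'M[R]_m)
    (W1 W2 : set 'cV[R]_m) : Prop :=
  (forall v, exists w1 w2, [/\ W1 w1, W2 w2 & v = w1 + w2]) /\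
  (forall w1 w2, W1 w1 -> W2 w2 -> metric G w1 w2 = 0).

(* For U open and V finite-dimensional, the existence and continuity of all
   iterated directional derivatives up to order k is the usual notion of C^k. *)
Fixpoint Ck (R : realType) (V W : normedModType R) (k : nat) (U : set V)
    (f : V -> W) : Prop :=
  match k with
  | 0%N => {in U, continuous f}
  | k'.+1 => {in U, continuous f} /\
      forall v : V, (forall x, U x -> derivable f x v) /\
                    Ck k' U (fun x => 'D_v f x)
  end.

Definition smooth_on (R : realType) (V W : normedModType R) (U : set V)
    (f : V -> W) : Prop := forall k, Ck k U f.

(* C^infty functions on a submanifold X of V: those that extend locally to
   smooth functions on open subsets of V. *)
Definition smooth_function (R : realType) (V : normedModType R) (X : set V)
    (a : V -> R) : Prop :=
  forall x, X x -> exists (U : set V) (F : V -> R),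
    [/\ open U, U x, smooth_on U F & forall y, X y -> U y -> F y = a y].

(* c, restricted to the open set U of R^d, is a homeomorphism onto an open
   subset of M, and iota \o c is an immersion on U. *)
Definition local_param (R : realType) (d : nat) (M : topologicalType)
    (V : normedModType R) (iota : M -> V)
    (U : set 'rV[R]_d) (c : 'rV[R]_d -> M) : Prop :=
  [/\ open U,
      {in U &, injective c} /\ {in U, continuous c},
      forall O : set 'rV[R]_d, open O -> O `<=` U -> open (c @` O),
      smooth_on U (iota \o c) &
      forall u v : 'rV[R]_d, U u -> 'D_v (iota \o c) u = 0 -> v = 0].

(* N is an (injectively immersed) connected submanifold of V, contained in X,
   whose tangent space at each point is the value of D there.  The topology of
   M may be finer than the one induced by V.  Transition maps between local
   parametrizations need no further condition: they are continuous, hence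
   smooth because iota \o c is an immersion.  M is Hausdorff because iota is
   injective and continuous, and it is second countable because it is moreover
   connected. *)
Definition connected_integral_submanifold (R : realType)
    (V : normedModType R) (X : set V) (D : V -> set V) (N : set V) : Prop :=
  N `<=` X /\
  exists (d : nat) (M : topologicalType) (iota : M -> V),
    [/\ injective iota,
        [set iota x | x in [set: M]] = N,
        connected [set: M] &
        forall x : M, exists (U : set 'rV[R]_d) (c : 'rV[R]_d -> M),
          [/\ local_param iota U c,
              exists2 u, U u & c u = x &
              forall u, U u ->
                [set 'D_v (iota \o c) u | v in [set: 'rV[R]_d]]
                = D (iota (c u))]].

Definition integrable_distribution (R : realType) (V : normedModType R)
    (X : set V) (D : V -> set V) : Prop :=
  forall x, X x -> exists2 N, connected_integral_submanifold X D N & N x.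

(* The leaf through x: the largest connected integral submanifold that
   contains x. *)
Definition is_leaf (R : realType) (V : normedModType R) (X : set V)
    (D : V -> set V) (x : V) (L : set V) : Prop :=
  [/\ connected_integral_submanifold X D L, L x &
      forall N, connected_integral_submanifold X D N -> N x -> N `<=` L].

(* det (t 1 - {J,K}) = t^m - f_1 t^(m-1) + f_2 t^(m-2) - ... ;
   f_coef J j K is f_(j+1) at K, for j = 0, ..., m-1. *)
Definition f_coef (R : realType) (m : nat) (J : 'M[R]_m) (j : 'I_m)
    (K : 'M[R]_m) : R :=
  (-1) ^+ j.+1 * (char_poly (acomm J K))`_(m - j.+1).

Definition Qsec (R : realType) (m : nat) (J : 'M[R]_m) (k : nat)
    (a : nat -> 'M[R]_m -> R) (K : 'M[R]_m) : 'M[R]_m :=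
  \sum_(i < k.+1) a i K *: (acomm J K ^+ i).

Definition distributionQS (R : realType) (m : nat) (G J : 'M[R]_m)
    (QS : 'M[R]_m -> 'M[R]_m) (K : 'M[R]_m) : set 'M[R]_m :=
  [set X | so_anti G K X /\
     exists C, [/\ u_alg G J C,
                   forall v, ker_space (QS K) v -> C *m v = 0,
                   forall w, im_space (QS K) w -> im_space (QS K) (C *m w) &
                   X = comm C K]].

(* Endomorphisms of a subspace W are represented by endomorphisms of the whole
   space that preserve W, of which only the restriction to W matters. *)
Definition unitary_on (R : realType) (m : nat) (G J : 'M[R]_m)
    (W : set 'cV[R]_m) : set 'M[R]_m :=
  [set A | [/\ stable A W,
      forall u v, W u -> W v -> metric G (A *m u) (A *m v) = metric G u v &
      forall w, W w -> A *m (J *m w) = J *m (A *m w)]].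

Definition unitary_orbit_on (R : realType) (m : nat) (G J : 'M[R]_m)
    (W : set 'cV[R]_m) (K : 'M[R]_m) : set 'M[R]_m :=
  [set L | exists A Ainv,
     [/\ unitary_on G J W A, unitary_on G J W Ainv,
         forall w, W w -> Ainv *m (A *m w) = w,
         forall w, W w -> A *m (Ainv *m w) = w &
         forall w, W w -> L *m w = A *m (K *m (Ainv *m w))]].

Definition leafQS (R : realType) (m : nat) (G J : 'M[R]_m)
    (QS : 'M[R]_m -> 'M[R]_m) (K : 'M[R]_m) : set 'M[R]_m :=
  [set K' | (forall v, ker_space (QS K) v -> K' *m v = K *m v) /\
            unitary_orbit_on G J (im_space (QS K)) K K'].

(* Main.v *)
Require Import Defs.
From HB Require Import structures.
From mathcomp Require Import all_boot all_order all_algebra separable.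
From mathcomp Require Import all_classical all_reals all_analysis.
From mathcomp Require mpoly.
From mathcomp Require Import ring lra.
Set Implicit Arguments.
Unset Strict Implicit.
Unset Printing Implicit Defensive.
Import Order.TTheory GRing.Theory Num.Theory.
Import numFieldNormedType.Exports.
Local Open Scope classical_set_scope.
Local Open Scope ring_scope.

(** The operator [P = QS(K)] is symmetric or skew for the metric, and [P J] and
    [P K] are of the form [X P], because [{J, K}] commutes with [J] and [K] while
    [S] preserves or exchanges them up to sign. Hence the kernel of [P] and its
    image are orthogonal complements and stable under [J] and [K], and the
    projection [p] onto the kernel is a polynomial [q(P)] ([kernel_poly_exists],
    [kernel_poly_proj]). In terms of [p] the distribution at [K] consists of the
    brackets [[C, K]] with [C] skew, commuting with [J] and [C p = 0], and the
    candidate leaf is the orbit of [K] under the unitary group [U_p] that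
    commutes with [J] and fixes the image of [p] ([distributionQSE], [leafQSE]).
    The coefficients of [Q] are functions of the characteristic polynomial of
    [{J, K}], so conjugation by [U_p] carries [QS(K)] to [QS(L)]; thus [p] is the
    same at all points of the orbit, and so is the Lie algebra of [U_p].

    The orbit, with the induced topology, is a submanifold. Near [K] it is
    parametrized by [x |-> c(X) K c(X)^-1], where [c] is the Cayley transform and
    [X = sum_i x_i C_i] for elements [C_i] whose brackets with [K] form a basis
    of the distribution. A difference of two values is a linear map applied to
    [x - y], with coefficients that depend continuously on [(x, y)]
    ([chart_sub]); this map is injective at the origin, hence nearby, which
    makes the parametrization both injective and immersive. For openness, let
    [L] be a point of the orbit close to the value at [x0]. The function
    [x |-> tr (chart(x) L)], which up to a constant is half the squared distance
    from [chart(x)] to [L], has a minimum in the interior of a small ball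
    ([chart_locally_surjective]). At a critical point with value [M], take an
    operator [B] close to the identity that commutes with [J] and satisfies
    [L B = B M]; moving in the direction of [B - B^*] and using criticality
    gives [tr ((L - M) B (L - M)) = 0], and therefore [M = L]
    ([level_set_critical]). Such a [B] is given by an explicit formula: as
    [J M] is orthogonal, its minimal polynomial [f] is separable, and the divided
    difference of [f] at the pair [(J L, J M)], normalized by [f'(J M)] and
    averaged over [J], intertwines the two ([intertwiner]).

    The orbit is connected because each element of [U_p] is a product of two
    Cayley transforms: multiplication by a suitable complex number of modulus
    one removes the eigenvalue [-1] ([unitary_cayley_decomposition]).

    For maximality, consider a curve [gamma] tangent to the distribution, so
    that its velocity is [[C, gamma]] with [C] skew, commuting with [J] and
    vanishing on the kernel of [QS]. Every polynomial expression in [J] and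
    [gamma] then evolves by the bracket with [C], and its trace is constant. So
    the minimal polynomial of [J gamma] at the start annihilates it throughout,
    [gamma] stays conjugate to [gamma(0)], and [p = q(QS(gamma))] has velocity
    [[C, p] = 0]. Therefore [gamma] agrees with [gamma(0)] on the image of [p]
    and stays in a set that coincides with the orbit near [gamma(0)]
    ([tangent_curve_level]). The points of a connected integral submanifold that
    lie on a given orbit thus form an open and closed set. *)

(** * Orthonormal frames and perturbations of the identity *)

(** Completing the square: by induction on the dimension, [T] clears the
    off-diagonal blocks and leaves the Schur complement [H'], which is again a
    metric. *)
Lemma metric_frame (R : realType) (m : nat) (G : 'M[R]_m) :
  is_metric G -> exists Q : 'M[R]_m, Q^T *m G *m Q = 1%:M.
Proof.
elim: m G => [|m IHm] G; first by exists 1%:M; apply/matrixP => - [].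
rewrite -[m.+1]/(1 + m)%N in G *; move=> [Gsym Gpos].
pose a := G ord0 ord0.
have metricE (u v : 'cV[R]_(1 + m)) : metric G u v = (u^T *m G *m v) 0 0 by [].
have a_gt0 : 0 < a.
  have := Gpos (delta_mx ord0 ord0); rewrite metricE.
  rewrite trmx_delta -rowE -colE !mxE; apply.
  by apply/eqP => /matrixP/(_ ord0 ord0)/eqP; rewrite !mxE /= oner_eq0.
pose b : 'cV[R]_m := dlsubmx G.
pose H : 'M[R]_m := drsubmx G.
have Gblock : G = block_mx a%:M b^T b H.
  rewrite -[LHS]submxK /b trmx_dlsub Gsym; congr block_mx.
  by rewrite [LHS]mx11_scalar !mxE lshift0.
pose s : 'M[R]_(1, m) := - a^-1 *: b^T.
pose T : 'M[R]_(1 + m) := block_mx 1%:M s 0 1%:M.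
pose H' : 'M[R]_m := H + b *m s.
have TGT : T^T *m G *m T = block_mx a%:M 0 0 H'.
  rewrite Gblock /T tr_block_mx !mulmx_block !trmx1 !trmx0.
  rewrite !(mul0mx, mul1mx, mulmx0, mulmx1, addr0, add0r).
  have as0 : a%:M *m s + b^T = 0.
    by rewrite mul_scalar_mx scalerA mulrN divff ?gt_eqF// scaleN1r addNr.
  have sa0 : s^T *m a%:M + b = 0.
    rewrite mul_mx_scalar linearZ /= trmxK scalerA mulrN divff ?gt_eqF//.
    by rewrite scaleN1r addNr.
  have sb : s^T *m b^T = b *m s.
    by rewrite /s linearZ /= trmxK -scalemxAl -scalemxAr.
  by rewrite as0 sa0 mul0mx add0r sb addrC.
have Tunit : T \in unitmx by rewrite unitmxE det_ublock !det1 mulr1 unitr1.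
have H'metric : is_metric H'.
  split.
    have Hsym : H^T = H by rewrite /H trmx_drsub Gsym.
    rewrite /H' linearD /= Hsym trmx_mul /s linearZ /= trmxK.
    by rewrite -scalemxAl -scalemxAr.
  move=> v v0; have [w wE] : exists w : 'cV[R]_(1 + m), w = col_mx 0 v.
    by exists (col_mx 0 v).
  have := Gpos (T *m w).
  rewrite metricE trmx_mul -!mulmxA !(mulmxA T^T) (mulmxA (T^T *m G)) TGT.
  rewrite {2 3}wE tr_col_mx mul_block_col mul_row_col trmx0 !mul0mx.
  rewrite !add0r mulmxA; apply; apply/eqP => Tv0.
  have : w = 0 by rewrite -(mulKmx Tunit w) Tv0 mulmx0.
  rewrite wE -col_mx0 => /eq_col_mx[_ v00].
  by rewrite v00 eqxx in v0.
have [Q' Q'1] := IHm H' H'metric.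
exists (T *m block_mx (Num.sqrt a)^-1%:M 0 0 Q').
rewrite trmx_mul -!mulmxA !(mulmxA T^T) (mulmxA (T^T *m G)) TGT.
rewrite tr_block_mx !mulmx_block !trmx0 tr_scalar_mx.
rewrite !(mul0mx, mulmx0, addr0, add0r) (mulmxA Q'^T) Q'1 -!scalar_mxM.
rewrite [_ * _](_ : _ = 1) ?scalar_mx_block//.
have sa : Num.sqrt a != 0 by rewrite gt_eqF ?sqrtr_gt0.
by rewrite -[X in _ * (X * _)](sqr_sqrtr (ltW a_gt0)); field.
Qed.

(** Perturbing the identity by entries of size at most [1/(2n)] perturbs the
    sum of squares by at most one half of itself, because
    [2 |x y| <= x^2 + y^2]. *)
Lemma near_one_mxtrace_gt0 (R : realFieldType) (n : nat) (B Y : 'M[R]_n) :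
  (forall i j, `|(B - 1%:M) i j| <= (2 * n%:R)^-1) -> Y != 0 ->
  0 < \tr (Y^T *m B *m Y).
Proof.
move=> Bnear Y0.
pose sq (k : 'I_n) := \sum_i (Y i k) ^+ 2.
have sq_ge0 k : 0 <= sq k by apply: sumr_ge0 => i _; apply: sqr_ge0.
have col_bound k : sq k / 2 <= (Y^T *m B *m Y) k k.
  pose E := B - 1%:M.
  have -> : B = 1%:M + E by rewrite addrC subrK.
  rewrite mulmxDr mulmx1 mulmxDl [leRHS]mxE.
  have -> : (Y^T *m Y) k k = sq k.
    by rewrite mxE; apply: eq_bigr => i _; rewrite mxE expr2.
  suff: `|(Y^T *m E *m Y) k k| <= sq k / 2.
    by rewrite ler_norml => /andP[]; lra.
  have n_gt0 : (0 < n%:R :> R) by rewrite ltr0n (leq_trans _ (ltn_ord k)).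
  rewrite mxE; apply: (le_trans (ler_norm_sum _ _ _)).
  apply: (@le_trans _ _ (\sum_i \sum_j
      (2 * n%:R)^-1 * ((Y j k ^+ 2 + Y i k ^+ 2) / 2))).
    apply: ler_sum => i _; rewrite mxE mulr_suml.
    apply: (le_trans (ler_norm_sum _ _ _)); apply: ler_sum => j _.
    rewrite !normrM mxE mulrAC mulrC ler_pM// ?mulr_ge0// ?Bnear//.
    have := sqr_ge0 (`|Y j k| - `|Y i k|).
    by rewrite -(real_normK (num_real (Y j k))) -(real_normK (num_real (Y i k))); nra.
  rewrite le_eqVlt; apply/orP; left; apply/eqP.
  under eq_bigr => i _ do rewrite -mulr_sumr -mulr_suml big_split /= sumr_const card_ord.
  rewrite -mulr_sumr -mulr_suml big_split /= sumr_const card_ord sumrMnl.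
  by rewrite -/(sq k) -mulr_natr; field; rewrite gt_eqF.
rewrite /mxtrace; apply: (@lt_le_trans _ _ (\sum_k sq k / 2)); last first.
  by apply: ler_sum => k _; apply: col_bound.
rewrite lt_neqAle sumr_ge0 ?andbT; last by move=> k _; rewrite divr_ge0.
apply: contra_neq Y0 => /esym/eqP; rewrite psumr_eq0; last first.
  by move=> k _; rewrite divr_ge0.
move=> /allP sq0; apply/matrixP => i k; rewrite mxE.
have /sq0 : k \in index_enum 'I_n by rewrite mem_index_enum.
rewrite mulf_eq0 invr_eq0 pnatr_eq0 orbF psumr_eq0 => [/allP/(_ i)|j _]; last exact: sqr_ge0.
by rewrite mem_index_enum sqrf_eq0 => /(_ isT)/eqP.
Qed.

(** * Adjoints with respect to a metric *)

(** Locked, so that its inverses and products are not unfolded during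
    unification. *)
HB.lock Definition adjoint (R : realType) (m : nat) (G A : 'M[R]_m.+1) : 'M[R]_m.+1 :=
  G^-1 * A^T * G.
Canonical adjoint_unlockable := Unlockable adjoint.unlock.

Section Adjoint.
Variables (R : realType) (m : nat) (G : 'M[R]_m.+1).
Hypothesis hG : is_metric G.
Local Notation adj := (adjoint G).
Implicit Types (A B C D N K P : 'M[R]_m.+1) (u v : 'cV[R]_m.+1).

Lemma metric_unit : G \is a GRing.unit.
Proof.
have [Q QGQ] := metric_frame hG.
have [_ Qu] := mulmx1_unit QGQ.
have := congr1 (fun X => \det X) QGQ; rewrite !det_mulmx det1 => d1.
rewrite -[_ \is a _]/(G \in unitmx) unitmxE unitfE.
by apply: contra_eq_neq d1 => ->; rewrite mulr0 mul0r eq_sym oner_eq0.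
Qed.

Lemma metric_sym : G^T = G. Proof. by case: hG. Qed.

Let trM A B : (A * B)^T = B^T * A^T. Proof. exact: trmx_mul. Qed.

Lemma adjD A B : adj (A + B) = adj A + adj B.
Proof. by rewrite unlock linearD mulrDr mulrDl. Qed.

Lemma adjZ a A : adj (a *: A) = a *: adj A.
Proof. by rewrite unlock linearZ -scalerAr -scalerAl. Qed.

Lemma adjN A : adj (- A) = - adj A.
Proof. by rewrite -scaleN1r adjZ scaleN1r. Qed.

Lemma adjB A B : adj (A - B) = adj A - adj B.
Proof. by rewrite adjD adjN. Qed.

Lemma adjoint0 : adj 0 = 0.
Proof. by rewrite -(scale0r 0) adjZ !scale0r. Qed.

Lemma adjoint1 : adj 1 = 1.
Proof. by rewrite unlock trmx1 mulr1 mulVr ?metric_unit. Qed.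

Lemma adjM A B : adj (A * B) = adj B * adj A.
Proof. by rewrite unlock trM !mulrA mulrK ?metric_unit. Qed.

Lemma adjK A : adj (adj A) = A.
Proof.
have GVT : (G^-1)^T = G^-1 by rewrite [LHS]trmx_inv metric_sym.
rewrite unlock !trM trmxK GVT metric_sym !mulrA.
by rewrite mulVr ?metric_unit// mul1r mulrVK ?metric_unit.
Qed.

Lemma adjX A k : adj (A ^+ k) = adj A ^+ k.
Proof. by elim: k => [|k IHk]; rewrite ?expr0 ?adjoint1// exprS adjM IHk exprSr. Qed.

Lemma adj_sum (I : finType) (F : I -> 'M[R]_m.+1) :
  adj (\sum_i F i) = \sum_i adj (F i).
Proof. by apply: (big_morph adj adjD adjoint0). Qed.

Lemma adj_horner A p : adj (horner_mx A p) = horner_mx (adj A) p.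
Proof.
elim/poly_ind: p => [|p c IHp]; first by rewrite !rmorph0 adjoint0.
rewrite !(rmorphD, rmorphM) /= !horner_mx_X !horner_mx_C adjD adjM IHp.
have -> : (c%:M : 'M[R]_m.+1) = c *: 1 by rewrite scalemx1.
rewrite adjZ adjoint1; congr (_ + _).
by rewrite -{1 4}(horner_mx_X (adj A)) -!rmorphM mulrC.
Qed.

Lemma metric_adjl A u v : metric G (A *m u) v = metric G u (adj A *m v).
Proof.
rewrite /metric trmx_mul unlock -[_ * _]/(_ *m _ *m _) !mulmxA.
have GGV : G *m G^-1 = 1%:M by exact: mulrV metric_unit.
by rewrite -(mulmxA _ G G^-1) GGV mulmx1.
Qed.

Lemma metricDr u v w : metric G u (v + w) = metric G u v + metric G u w.
Proof. by rewrite /metric mulmxDr mxE. Qed.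

Lemma metric_eq0 v : metric G v v = 0 -> v = 0.
Proof.
move=> v0; apply/eqP; apply: contra_eqT v0 => v_neq0.
by rewrite gt_eqF//; case: hG => _; apply.
Qed.

Lemma metric_nondegenerate A B :
  (forall u v, metric G u (A *m v) = metric G u (B *m v)) -> A = B.
Proof.
move=> AB; apply/subr0_eq/matrixP => i j.
pose v : 'cV[R]_m.+1 := delta_mx j 0.
suff: (A - B) *m v = 0 by rewrite -colE => /matrixP/(_ i 0); rewrite !mxE.
apply: metric_eq0; move: (X in metric G X) => u.
rewrite /metric mulmxBl mulmxBr mxE [X in _ + X = _]mxE.
by have := AB u v; rewrite /metric => ->; rewrite subrr.
Qed.

Lemma mxtrace_adj A : \tr (adj A) = \tr A.
Proof.
rewrite unlock [LHS]mxtrace_mulC [_ *m _]mulrA mulrV ?metric_unit// mul1r.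
exact: mxtrace_tr.
Qed.

Lemma so_algP A : so_alg G A <-> adj A = - A.
Proof.
split=> [Aso|Aso u v]; last first.
  rewrite metric_adjl Aso -metricDr mulNmx addNr /metric mulmx0 mxE //.
apply: metric_nondegenerate => u v; rewrite -metric_adjl mulNmx.
apply/eqP; rewrite -subr_eq0; have := Aso u v.
by rewrite [metric G u (- _)]/metric mulmxN mxE opprK => ->.
Qed.

Lemma twistorP K : twistor G K <-> K * K = -1 /\ adj K = - K.
Proof.
split=> -[KK Kg]; split=> //.
  have : adj K * K = 1.
    apply: metric_nondegenerate => u v; rewrite -mulmxA -metric_adjl Kg.
    by rewrite mul1mx.
  move=> /(congr1 (fun X => X * K)); rewrite -mulrA [K * K]KK mulrN mulr1 mul1r.
  by move=> /(congr1 -%R); rewrite opprK.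
move=> u v; rewrite metric_adjl mulmxA Kg -[_ *m K]/(- K * K) mulNr [K * K]KK opprK.
by rewrite mul1mx.
Qed.

(** Closeness to the identity, measured in a [G]-orthonormal frame [Q]. *)
Definition near_one (Q B : 'M[R]_m.+1) :=
  forall i j, `|(Q^-1 * B * Q - 1) i j| <= (2 * m.+1%:R)^-1.

Section Frame.
Variable Q : 'M[R]_m.+1.
Hypothesis QGQ : Q^T *m G *m Q = 1%:M.

Lemma frame_unit : Q \is a GRing.unit.
Proof. by have [] := mulmx1_unit QGQ. Qed.

Lemma near_one_refl : near_one Q 1.
Proof.
move=> i j; rewrite mulr1 mulVr ?frame_unit// subrr mxE normr0 invr_ge0.
by rewrite mulr_ge0 ?ler0n.
Qed.

(** In the frame [Q] the adjoint is the transpose, so that the trace is the sum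
    of the values of the bilinear form of [B] on the columns of [D]. *)
Lemma mxtrace_near_one_gt0 B D :
  near_one Q B -> D != 0 -> 0 < \tr (adj D * B * D).
Proof.
move=> Bnear D0; have Qu := frame_unit.
have GE : Q^T * G = Q^-1.
  by apply: (mulIr Qu); rewrite mulVr// -[RHS]QGQ.
have [Y YE] : exists Y, Y = Q^-1 * D * Q by eexists.
have DE : D = Q * Y * Q^-1 by rewrite YE !mulrA mulrV// mul1r mulrK.
have aDE : adj D = Q * Y^T * Q^-1.
  have GVE : G^-1 = Q * Q^T.
    apply: (mulIr metric_unit); rewrite mulVr ?metric_unit//.
    by rewrite -mulrA GE mulrV.
  have QQ : Q^T * (Q^-1)^T = 1 by rewrite -trM mulVr// [LHS]trmx1.
  rewrite unlock DE !trM GVE !mulrA -(mulrA Q Q^T) QQ mulr1.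
  by rewrite -!mulrA GE.
have -> : \tr (adj D * B * D) = \tr (Y^T *m (Q^-1 * B * Q) *m Y).
  have trC A C : \tr (A * C) = \tr (C * A) by exact: mxtrace_mulC.
  rewrite aDE DE -!mulrA trC -[RHS]/(\tr (_ * _ * _)) !mulrA mulrVK//.
apply: near_one_mxtrace_gt0 => //; apply: contra_neq D0 => Y0.
by rewrite DE Y0 mulr0 mul0r.
Qed.

Lemma near_one_unit B : near_one Q B -> B \is a GRing.unit.
Proof.
move=> Bnear; rewrite -[_ \is a _]/(B \in unitmx) -row_full_unit -cokermx_eq0.
apply/negPn/negP => /(mxtrace_near_one_gt0 Bnear).
by rewrite -mulrA [B * _]mulmx_coker mulr0 mxtrace0 ltxx.
Qed.

End Frame.

Lemma adjM_eq0 A : adj A * A = 0 -> A = 0.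
Proof.
have [Q QGQ] := metric_frame hG.
move=> AA; apply/eqP/negPn/negP => /(mxtrace_near_one_gt0 QGQ (near_one_refl QGQ)).
by rewrite mulr1 AA mxtrace0 ltxx.
Qed.

Lemma mxtrace_adjM_eq0 A : \tr (adj A * A) = 0 -> A = 0.
Proof.
have [Q QGQ] := metric_frame hG.
move=> AA; apply/eqP/negPn/negP => /(mxtrace_near_one_gt0 QGQ (near_one_refl QGQ)).
by rewrite mulr1 AA ltxx.
Qed.

(** [(N^* N)^2 = N^*^2 N^2] for a normal [N]. *)
Lemma normal_sqr_eq0 N : adj N * N = N * adj N -> N * N = 0 -> N = 0.
Proof.
move=> Nnormal NN; apply: adjM_eq0; apply: adjM_eq0.
by rewrite adjM adjK mulrA -(mulrA _ N) -Nnormal -!mulrA NN !mulr0.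
Qed.

(** [(P A)^* (P A) = s A^* P P A], so a symmetric or skew operator has the same
    kernel as its square. *)
Lemma skew_symm_ker (s : R) P A :
  adj P = s *: P -> P * (P * A) = 0 -> P * A = 0.
Proof.
move=> Ps PPA; apply: adjM_eq0.
by rewrite adjM Ps -mulrA -scalerAl PPA scaler0 mulr0.
Qed.

End Adjoint.

(** * Divided differences and intertwiners *)

Section DividedDifference.
Variables (R : realType) (m : nat).
Implicit Types (A B P : 'M[R]_m.+1) (s : seq R).

(** [(p(x) - p(y)) / (x - y)] evaluated at a non-commuting pair: the powers of
    [A] are written to the left of those of [B]. *)
Fixpoint divided_difference s A B : 'M[R]_m.+1 :=
  if s is c :: s' then horner_mx A (Poly s') + divided_difference s' A B * B
  else 0.

Lemma horner_mx_cons A c s :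
  horner_mx A (Poly (c :: s)) = horner_mx A (Poly s) * A + c%:M.
Proof. by rewrite /= cons_poly_def rmorphD rmorphM /= horner_mx_X horner_mx_C. Qed.

Lemma horner_mxC A p : A * horner_mx A p = horner_mx A p * A.
Proof. exact: comm_mx_horner. Qed.

Lemma divided_difference_intertwines s A B :
  A * divided_difference s A B - divided_difference s A B * B
  = horner_mx A (Poly s) - horner_mx B (Poly s).
Proof.
elim: s => [|c s IHs]; first by rewrite /= !rmorph0 mulr0 mul0r.
rewrite !horner_mx_cons [divided_difference _ _ _]/= mulrDr mulrDl horner_mxC.
set d := divided_difference s A B in IHs *.
set p := horner_mx _ _ in IHs *; set q := horner_mx _ _ in IHs *.
rewrite [in RHS]opprD addrACA subrr addr0 opprD addrACA.
by rewrite mulrA -mulrBl IHs mulrBl subrKA.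
Qed.

Lemma divided_difference_diag s A :
  divided_difference s A A = horner_mx A (Poly s)^`().
Proof.
elim: s => [|c s IHs]; first by rewrite /= deriv0 rmorph0.
rewrite /= IHs cons_poly_def derivD derivC addr0 derivM derivX mulr1.
by rewrite rmorphD rmorphM /= horner_mx_X addrC.
Qed.

Lemma horner_mx_eq_on A B P p :
  A * P = B * P -> GRing.comm B P -> horner_mx A p * P = horner_mx B p * P.
Proof.
move=> ABP BP; elim/poly_ind: p => [|p c IHp]; first by rewrite !rmorph0.
rewrite !(rmorphD, rmorphM) /= !horner_mx_X !horner_mx_C !mulrDl.
by rewrite -!mulrA ABP BP !mulrA IHp.
Qed.

(** Operators that coincide on the image of [P] have equal divided differences
    there; this is how an intertwiner acquires [B P = P]. *)
Lemma divided_difference_eq_on s A B P :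
  A * P = B * P -> GRing.comm B P ->
  divided_difference s A B * P = divided_difference s B B * P.
Proof.
move=> ABP BP; elim: s => [|c s IHs]; first by [].
rewrite /= !mulrDl (horner_mx_eq_on _ ABP)//; congr (_ + _).
by rewrite -!mulrA BP !mulrA IHs.
Qed.

Lemma horner_mx_eq_on_l A B P p :
  P * A = P * B -> GRing.comm P B -> P * horner_mx A p = P * horner_mx B p.
Proof.
move=> PAB PB; elim/poly_ind: p => [|p c IHp]; first by rewrite !rmorph0.
rewrite !(rmorphD, rmorphM) /= !horner_mx_X !horner_mx_C !mulrDr.
have Pp : P * horner_mx B p = horner_mx B p * P by apply: comm_mx_horner.
by rewrite !mulrA IHp Pp -!mulrA PAB.
Qed.

Lemma divided_difference_eq_on_l s A B P :
  P * A = P * B -> GRing.comm P B ->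
  P * divided_difference s A B = P * divided_difference s B B.
Proof.
move=> PAB PB; elim: s => [|c s IHs]; first by [].
by rewrite /= !mulrDr (horner_mx_eq_on_l _ PAB)// !mulrA IHs.
Qed.

End DividedDifference.

Section Intertwiner.
Variables (R : realType) (m : nat) (G J : 'M[R]_m.+1).
Hypothesis hG : is_metric G.
Hypothesis JJ : J * J = -1.
Local Notation adj := (adjoint G).
Local Notation minpoly K := (mxminpoly (J * K)).
Implicit Types (A K P : 'M[R]_m.+1).

(** A square factor [d^2] of the minimal polynomial [h d^2] would make
    [(h d)(A)] a normal operator of square zero, hence zero. *)
Lemma normal_separable_mxminpoly A :
  adj A * A = A * adj A -> separable_poly (mxminpoly A).
Proof.
move=> Anormal; apply/separable_polyP; split=> [u v uv|u _ u1]; last first.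
  apply/eqP => /(congr1 (fun q : {poly R} => q`_(size u).-2)).
  have su : (size u).-2.+1 = (size u).-1 by case: (size u) u1 => [|[]].
  rewrite coef_deriv coef0 su => /eqP; rewrite mulrn_eq0 -lead_coefE lead_coef_eq0.
  by rewrite -size_poly_eq0; case: (size u) u1 => [|[]].
set p := mxminpoly A in uv *; pose d := gcdp u v.
have p0 : p != 0 by rewrite monic_neq0 ?mxminpoly_monic.
have : d * d %| p by apply: dvdp_trans uv; rewrite dvdp_mul ?dvdp_gcdl ?dvdp_gcdr.
move=> /dvdpP[h pE].
have hdA : horner_mx A (h * d) = 0.
  apply: (normal_sqr_eq0 hG).
    rewrite adj_horner//; apply: comm_mx_horner; apply: comm_horner_mx.
    exact: Anormal.
  rewrite -rmorphM (_ : h * d * (h * d) = h * p); last by rewrite pE; ring.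
  by rewrite rmorphM /= mx_root_minpoly mulr0.
have := mxminpoly_min hdA; rewrite -/p pE mulrA -[X in _ %| X]mulr1 dvdp_mul2l.
  by rewrite dvdp1 /coprimep.
by apply: contra_neq p0; rewrite pE mulrA => ->; rewrite mul0r.
Qed.

(** In this section [e] is meant to be a Bezout inverse of the derivative modulo
    the minimal polynomial. *)
Section Witness.
Variables (K1 : 'M[R]_m.+1) (e : {poly R}).

(** The first factor intertwines [J K] and [J L] when both are annihilated by
    the minimal polynomial [f] of [J K1], and equals [f'(J K)] for [K = L].
    The second is the inverse of [f'(J K)]. The average over the group
    generated by [J] makes the result commute with [J]. *)
Definition intertwiner K L : 'M[R]_m.+1 :=
  let B := divided_difference (minpoly K1) (J * L) (J * K) * horner_mx (J * K) e in
  2^-1 *: (B - J * B * J).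

Definition isospectral K := horner_mx (J * K) (minpoly K1) = 0.

Lemma intertwinerJ K L : J * intertwiner K L = intertwiner K L * J.
Proof.
rewrite /intertwiner; set B := _ * horner_mx _ _.
rewrite -scalerAr -scalerAl mulrBr mulrBl !mulrA JJ !mulNr mul1r opprK.
by rewrite -[_ * J * J]mulrA JJ mulrN1 opprK addrC.
Qed.

(** [B] intertwines [J K] and [J L]. Inverting these operators, it intertwines
    [K J] and [L J] as well, so [J B J] intertwines [J K] and [J L] too. Once the
    average commutes with [J], the factor [J] can be cancelled. *)
Lemma intertwinerP K L : K * K = -1 -> L * L = -1 ->
  isospectral K -> isospectral L -> L * intertwiner K L = intertwiner K L * K.
Proof.
move=> KK LL isoK isoL; have := intertwinerJ K L.
rewrite /intertwiner; set B := _ * horner_mx _ _ => Jb.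
have JB : J * L * B = B * (J * K).
  rewrite /B mulrA -[RHS]mulrA -horner_mxC mulrA; congr (_ * _).
  apply/subr0_eq; rewrite divided_difference_intertwines polyseqK.
  by rewrite isoK isoL subrr.
clearbody B.
have BKJ : B * (K * J) = L * J * B.
  have JLLJ : L * J * (J * L) = 1 by rewrite -mulrA (mulrA J) JJ mulN1r mulrN LL opprK.
  have JKKJ : J * K * (K * J) = 1 by rewrite -mulrA (mulrA K) KK mulN1r mulrN JJ opprK.
  by rewrite -[LHS]mul1r -JLLJ -(mulrA (L * J)) (mulrA (J * L)) JB -(mulrA B) JKKJ mulr1.
have JB' : J * L * (J * B * J) = J * B * J * (J * K).
  rewrite -!mulrA (mulrA L J) (mulrA (L * J)) -BKJ -!mulrA JJ (mulrA J J) JJ.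
  by rewrite mulN1r !mulrN mulr1.
set b := _ *: _ in Jb *.
have Ab : J * L * b = b * (J * K).
  by rewrite /b -scalerAr -scalerAl mulrBr mulrBl JB JB'.
have LE : L = - (J * (J * L)) by rewrite mulrA JJ mulN1r opprK.
rewrite LE mulNr -mulrA Ab (mulrA J) Jb -mulrA (mulrA J) JJ mulN1r mulrN.
by rewrite opprK.
Qed.

Hypothesis eP : exists w, e * (minpoly K1)^`() + w * minpoly K1 = 1.

Lemma intertwiner_diag K : isospectral K -> intertwiner K K = 1.
Proof.
move=> isoK; case: eP => w /(congr1 (horner_mx (J * K))).
rewrite rmorphD !rmorphM /= isoK mulr0 addr0 rmorph1 => ef'.
rewrite /intertwiner divided_difference_diag polyseqK.
rewrite (comm_horner_mx2 _ _ e) ef' mulr1 JJ opprK.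
by rewrite scalerDr -scalerDl [X in X *: _](_ : _ = 1) ?scale1r//; field.
Qed.

Lemma intertwiner_eq_on K L P : isospectral K ->
  GRing.comm J P -> GRing.comm K P -> L * P = K * P -> intertwiner K L * P = P.
Proof.
move=> isoK JP KP LPKP; rewrite -[RHS]mul1r -(intertwiner_diag isoK).
have AP : J * L * P = J * K * P by rewrite -!mulrA LPKP.
have A'P : GRing.comm (J * K) P by apply/commr_sym; apply: commrM; apply/commr_sym.
have eP' : GRing.comm (horner_mx (J * K) e) P by apply: comm_horner_mx.
rewrite /intertwiner -!scalerAl !mulrBl; congr (_ *: (_ - _)).
  by rewrite -!mulrA eP' !mulrA (divided_difference_eq_on _ AP).
rewrite -!mulrA; congr (_ * _); rewrite JP !mulrA; congr (_ * _).
by rewrite -!mulrA eP' !mulrA (divided_difference_eq_on _ AP).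
Qed.

Lemma intertwiner_eq_on_l K L P : isospectral K ->
  GRing.comm J P -> GRing.comm K P -> P * L = P * K -> P * intertwiner K L = P.
Proof.
move=> isoK JP KP PLPK; rewrite -[RHS]mulr1 -(intertwiner_diag isoK).
have PJ : P * J = J * P by rewrite JP.
have PA : P * (J * L) = P * (J * K) by rewrite !mulrA PJ -!mulrA PLPK.
have PA' : GRing.comm P (J * K) by apply: commrM; apply/commr_sym.
rewrite /intertwiner -!scalerAr !mulrBr; congr (_ *: (_ - _)).
  by rewrite !mulrA (divided_difference_eq_on_l _ PA).
rewrite !mulrA PJ -!mulrA; congr (_ * _); rewrite !mulrA.
by rewrite (divided_difference_eq_on_l _ PA).
Qed.

End Witness.
End Intertwiner.

(** * Kernel projections as polynomials *)

Section Conjugation.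
Variables (R : realType) (m : nat).
Implicit Types A B C : 'M[R]_m.+1.

Lemma char_poly_intertwined A C B :
  B \is a GRing.unit -> B * A = C * B -> char_poly A = char_poly C.
Proof.
move=> Bu BA; pose b := map_mx polyC B; pose b' := map_mx polyC B^-1.
have bb' : \det b' * \det b = 1.
  by rewrite -det_mulmx -map_mxM -[_ *m _]/(_ * _) mulVr// map_mx1 det1.
have bA : b *m char_poly_mx A = char_poly_mx C *m b.
  rewrite /char_poly_mx mulmxBr mulmxBl -!map_mxM -[B *m A]/(B * A) BA.
  by rewrite scalar_mxC.
have := congr1 (fun X => \det b' * \det X) bA.
rewrite /= !det_mulmx mulrA bb' mul1r mulrCA bb' mulr1.
exact.
Qed.

Lemma horner_mx_intertwined A C B p :
  B * A = C * B -> B * horner_mx A p = horner_mx C p * B.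
Proof.
move=> BA; elim/poly_ind: p => [|p c IHp]; first by rewrite !rmorph0 mulr0 mul0r.
rewrite !(rmorphD, rmorphM) /= !horner_mx_X !horner_mx_C mulrDr mulrDl.
by rewrite mulrA IHp -!mulrA BA -[B * c%:M]/(_ *m _) scalar_mxC.
Qed.

End Conjugation.

Section KernelProjection.
Variables (R : realType) (m : nat) (G : 'M[R]_m.+1).
Hypothesis hG : is_metric G.
Local Notation adj := (adjoint G).
Implicit Types (P T p X : 'M[R]_m.+1) (q r : {poly R}).

(** For such a [q], the matrix [q(P)] is the projection onto the kernel of [P]
    along its image. Keeping the polynomial rather than the matrix lets the
    projection follow [P] under conjugation and along curves. *)
Definition kernel_poly P q :=
  (exists r, q + 'X * r = 1) /\ horner_mx P ('X * q) = 0.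

(** Split the minimal polynomial as ['X^k g] with [g(0)] nonzero. Since the
    kernel of [P] is that of its square, [P^k g(P) = 0] already gives
    [P g(P) = 0], so [g] normalized by [g(0)] will do. *)
Lemma kernel_poly_exists (s : R) P : adj P = s *: P -> exists q, kernel_poly P q.
Proof.
move=> aP; pose f := mxminpoly P.
have [k [g + fE]] := multiplicity_XsubC f 0.
have f0 : f != 0 by rewrite monic_neq0 ?mxminpoly_monic.
rewrite f0 /= => g0; rewrite subr0 in fE.
have gk : P ^+ k * horner_mx P g = 0.
  rewrite -[P in P ^+ k](horner_mx_X P) -rmorphXn -rmorphM /= mulrC -fE.
  exact: mx_root_minpoly.
have Pg : P * horner_mx P g = 0.
  elim: k gk {fE} => [|k IHk] gk; first by rewrite mul1r in gk; rewrite gk mulr0.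
  case: k IHk gk => [|k] IHk gk; first exact: gk.
  apply: IHk; rewrite exprS -mulrA; apply: (skew_symm_ker hG aP).
  by move: gk; rewrite !exprS -!mulrA.
have c0 : g.[0] != 0 by [].
exists (g.[0]^-1 *: g); split; last first.
  by rewrite -scalerAr linearZ rmorphM /= horner_mx_X Pg scaler0.
have /factor_theorem[r] : root (1 - g.[0]^-1 *: g) 0.
  by rewrite /root !(hornerE, hornerZ) mulVf// subrr.
rewrite subr0 => rE; exists r.
by rewrite mulrC -rE addrC subrK.
Qed.

Section WithPoly.
Variables (P : 'M[R]_m.+1) (q : {poly R}) (s : R).
Hypothesis aP : adj P = s *: P.
Hypothesis qP : kernel_poly P q.
Local Notation p := (horner_mx P q).

Lemma mul_kernel_proj : P * p = 0.
Proof. by case: qP => _; rewrite rmorphM /= horner_mx_X. Qed.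

Lemma kernel_proj_mul : p * P = 0.
Proof. by rewrite -horner_mxC mul_kernel_proj. Qed.

Lemma kernel_proj_compl : exists r, 1 - p = horner_mx P r * P.
Proof.
case: qP => -[r qr] _; exists r; rewrite -[X in _ * X](horner_mx_X P) -rmorphM mulrC.
by rewrite -(rmorph1 (horner_mx P)) -qr rmorphD addrC addKr.
Qed.

Lemma kernel_proj_idem : p * p = p.
Proof.
case: kernel_proj_compl => r pE; apply/esym/subr0_eq.
by rewrite -[X in X - _]mul1r -mulrBl pE -mulrA mul_kernel_proj mulr0.
Qed.

(** The range of [1 - p] is contained in that of [P], on which [p^*] vanishes;
    this gives [p^* = p^* p]. *)
Lemma adj_kernel_proj : adj p = p.
Proof.
have [r pE] := kernel_proj_compl.
have app : adj p = adj p * p.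
  apply/subr0_eq; rewrite -[X in X - _]mulr1 -mulrBr pE -horner_mxC mulrA.
  have -> : adj p * P = 0; last by rewrite mul0r.
  by rewrite -[LHS](adjK hG) adjM// adjK// aP -scalerAl mul_kernel_proj scaler0 adjoint0.
by rewrite -[RHS](adjK hG) app adjM// adjK// -app.
Qed.

(** [P K = X P] says that [K] preserves the kernel of [P]; as [K] is skew it
    also preserves the orthogonal complement. *)
Lemma kernel_proj_stable K X : adj K = - K -> P * K = X * P -> GRing.comm K p.
Proof.
move=> aK PK; have [r pE] := kernel_proj_compl.
have pKp : K * p = p * K * p.
  apply/subr0_eq; rewrite -mulrA -[X in X - _]mul1r -mulrBl pE.
  by rewrite -mulrA (mulrA P) PK -(mulrA X) mul_kernel_proj !mulr0.
have := congr1 adj pKp; rewrite !adjM// aK adj_kernel_proj.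
rewrite !(mulrN, mulNr) => /oppr_inj pK.
by rewrite /GRing.comm pKp [RHS]pK mulrA.
Qed.

Lemma ker_spaceE : ker_space P = [set v | p *m v = v].
Proof.
apply/seteqP; split=> v /=; last first.
  by move=> pv; rewrite /ker_space /= -pv mulmxA [P *m p]mul_kernel_proj mul0mx.
rewrite /ker_space /= => Pv; have [r pE] := kernel_proj_compl.
have : (1 - p) *m v = 0 by rewrite pE -[_ * P]/(_ *m P) -mulmxA Pv mulmx0.
by rewrite mulmxBl mul1mx => /subr0_eq.
Qed.

Lemma im_spaceE : im_space P = [set v | p *m v = 0].
Proof.
apply/seteqP; split=> v /=.
  by move=> [w _ <-]; rewrite mulmxA [p *m P]kernel_proj_mul mul0mx.
move=> pv; have [r pE] := kernel_proj_compl.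
exists (horner_mx P r *m v) => //; rewrite mulmxA [P *m _]horner_mxC -pE.
by rewrite mulmxBl mul1mx pv subr0.
Qed.

End WithPoly.
End KernelProjection.

(** * The algebra generated by two complex structures *)

Section TwistorAlgebra.
Variables (R : realType) (m : nat) (G J : 'M[R]_m.+1).
Hypothesis hG : is_metric G.
Hypothesis JJ : J * J = -1.
Hypothesis aJ : adjoint G J = - J.
Local Notation adj := (adjoint G).
Implicit Types (K L B : 'M[R]_m.+1) (b : nat -> R).

Lemma acomm_commJ K : GRing.comm (acomm J K) J.
Proof.
rewrite /GRing.comm /acomm -![_ *m _]/(_ * _) mulrDl mulrDr.
by rewrite (mulrA J J) JJ mulN1r -(mulrA K) JJ mulrN1 addrC mulrA.
Qed.

Lemma acomm_commK K : K * K = -1 -> GRing.comm (acomm J K) K.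
Proof.
move=> KK; rewrite /GRing.comm /acomm -![_ *m _]/(_ * _) mulrDl mulrDr.
by rewrite -(mulrA J) KK mulrN1 (mulrA K K) KK mulN1r addrC mulrA.
Qed.

Lemma adj_acomm K : adj K = - K -> adj (acomm J K) = acomm J K.
Proof.
move=> aK; rewrite /acomm -![_ *m _]/(_ * _) adjD !adjM// aJ aK !mulrNN.
by rewrite addrC.
Qed.

Lemma acomm_intertwined K L B :
  GRing.comm B J -> B * K = L * B -> B * acomm J K = acomm J L * B.
Proof.
move=> BJ BK; rewrite /acomm -![_ *m _]/(_ * _) mulrDl mulrDr.
by rewrite (mulrA B J) BJ -(mulrA J B) BK (mulrA B K) BK -(mulrA L B) BJ !mulrA.
Qed.

Variable S : 'M[R]_m.+1 -> 'M[R]_m.+1.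
Hypothesis hS : [\/ S = (fun K => 1%:M), S = (fun K => J + K),
                    S = (fun K => J - K) | S = (fun K => comm J K)].

(** Each of the four choices of [S] exchanges [J] and [K] or preserves them, up
    to a sign. The multiplier being [J] or [K] up to sign, it commutes with
    [{J, K}] and can be moved past [Q]. *)
Lemma S_exchange K : K * K = -1 ->
  (exists2 X, S K * J = X * S K & GRing.comm (acomm J K) X) /\
  (exists2 Y, S K * K = Y * S K & GRing.comm (acomm J K) Y).
Proof.
move=> KK; have MJ := acomm_commJ K; have MK := acomm_commK KK.
have MNJ := commrN MJ; have MNK := commrN MK.
case: hS => ->; split.
- by exists J => //; rewrite mul1r mulr1.
- by exists K => //; rewrite mul1r mulr1.
- by exists K => //; rewrite mulrDl mulrDr JJ KK addrC.
- by exists J => //; rewrite mulrDl mulrDr JJ KK addrC.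
- by exists (- K) => //; rewrite mulrBl mulrBr JJ !mulNr KK opprK addrC.
- by exists (- J) => //; rewrite mulrBl mulrBr !mulNr JJ KK !opprK addrC.
- exists (- J) => //; rewrite /comm -![_ *m _]/(_ * _) mulrBl mulrBr !mulNr.
  by rewrite (mulrA J J) JJ mulN1r -(mulrA K) JJ mulrN1 !opprK addrC mulrA.
- exists (- K) => //; rewrite /comm -![_ *m _]/(_ * _) mulrBl mulrBr !mulNr.
  by rewrite (mulrA K K) KK mulN1r -(mulrA J) KK mulrN1 !opprK addrC !mulrA.
Qed.

Lemma S_symmetry : exists s : R, forall K, adj K = - K -> adj (S K) = s *: S K.
Proof.
case: hS => ->; [exists 1|exists (-1)..] => K aK; rewrite ?scale1r ?scaleN1r.
- exact: (adjoint1 hG).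
- by rewrite adjD aJ aK opprD.
- by rewrite adjB aJ aK opprD.
- by rewrite /comm -![_ *m _]/(_ * _) adjB !adjM// aJ aK !mulrNN opprB.
Qed.

Lemma S_comm K : K * K = -1 -> GRing.comm (acomm J K) (S K).
Proof.
move=> KK; have MJ := acomm_commJ K; have MK := acomm_commK KK.
case: hS => ->; [exact: commr1|exact: commrD|exact: commrB|].
by rewrite /comm -![_ *m _]/(_ * _); apply: commrB; apply: commrM.
Qed.

Lemma S_intertwined K L B :
  GRing.comm B J -> B * K = L * B -> B * S K = S L * B.
Proof.
move=> BJ BK; case: hS => ->.
- by rewrite mulr1 mul1r.
- by rewrite mulrDl mulrDr BJ BK.
- by rewrite mulrBl mulrBr BJ BK.
- rewrite /comm -![_ *m _]/(_ * _) mulrBl mulrBr.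
  by rewrite (mulrA B J) BJ -(mulrA J B) BK (mulrA B K) BK -(mulrA L B) BJ !mulrA.
Qed.

Variable k : nat.

(** [QS] with its coefficients frozen. The coefficients turn out to be constant
    along orbits and tangent curves, where this polynomial expression in [J] and
    [K] can therefore replace [QS]. *)
Definition QS_const b K : 'M[R]_m.+1 :=
  (\sum_(i < k.+1) b i *: acomm J K ^+ i) * S K.

Lemma sum_acomm_comm b K X : GRing.comm (acomm J K) X ->
  GRing.comm (\sum_(i < k.+1) b i *: acomm J K ^+ i) X.
Proof.
move=> MX; apply/commr_sym/commr_sum => i _.
rewrite /GRing.comm -scalerAl -scalerAr; congr (_ *: _).
exact/commrX/commr_sym.
Qed.

Lemma QS_exchange b K : K * K = -1 ->
  (exists X, QS_const b K * J = X * QS_const b K) /\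
  (exists Y, QS_const b K * K = Y * QS_const b K).
Proof.
move=> /S_exchange[[X SJ MX] [Y SK MY]]; split; [exists X|exists Y].
  by rewrite /QS_const -mulrA SJ !mulrA sum_acomm_comm.
by rewrite /QS_const -mulrA SK !mulrA sum_acomm_comm.
Qed.

(** The sign [s] depends on the choice of [S] alone: [Q] is symmetric and
    commutes with [S]. *)
Lemma QS_symmetry : exists s : R, forall b K, K * K = -1 -> adj K = - K ->
  adj (QS_const b K) = s *: QS_const b K.
Proof.
have [s sP] := S_symmetry; exists s => b K KK aK.
rewrite /QS_const adjM// sP// -scalerAl (sum_acomm_comm b (S_comm KK)).
rewrite adj_sum; congr (_ *: (_ * _)); apply: eq_bigr => i _.
by rewrite adjZ adjX// adj_acomm.
Qed.

Lemma QS_intertwined b K L B :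
  GRing.comm B J -> B * K = L * B -> B * QS_const b K = QS_const b L * B.
Proof.
move=> BJ BK; rewrite /QS_const -[RHS]mulrA -(S_intertwined BJ BK) !mulrA.
congr (_ * _); rewrite mulr_sumr mulr_suml; apply: eq_bigr => i _.
rewrite -scalerAl -scalerAr; congr (_ *: _).
elim: (nat_of_ord i) => [|j IHj]; first by rewrite !expr0 mulr1 mul1r.
by rewrite !exprS mulrA (acomm_intertwined BJ BK) -mulrA IHj mulrA.
Qed.

End TwistorAlgebra.

(** * Pointwise description of the distribution and of the leaf *)

Section PointwiseDescription.
Variables (R : realType) (m : nat) (G J : 'M[R]_m.+1).
Hypothesis hG : is_metric G.
Local Notation adj := (adjoint G).
Implicit Types (A B C K L X p : 'M[R]_m.+1).

(** When [p] is the projection onto the kernel of [QS], these are the Lie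
    algebra and the group of unitary transformations of the image of [QS],
    extended to the whole space by zero and by the identity. *)
Definition u_alg_fixing p : set 'M[R]_m.+1 :=
  [set C | [/\ adj C = - C, GRing.comm C J & C * p = 0]].

Definition unitary_fixing p : set 'M[R]_m.+1 :=
  [set B | [/\ adj B * B = 1, GRing.comm B J & B * p = p]].

Lemma adjoint_inv B : adj B * B = 1 -> B * adj B = 1.
Proof. by move=> /mulmx1C. Qed.

Lemma unitary_fixing1 p : unitary_fixing p 1.
Proof. by split; [rewrite adjoint1 ?mulr1|apply/commr_sym/commr1|rewrite mul1r]. Qed.

Lemma unitary_fixingM p A B :
  unitary_fixing p A -> unitary_fixing p B -> unitary_fixing p (A * B).
Proof.
move=> [A1 AJ Ap] [B1 BJ Bp]; split.
- by rewrite adjM// mulrA -(mulrA (adj B)) A1 mulr1.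
- exact/commr_sym/commrM/commr_sym/BJ/commr_sym.
- by rewrite -mulrA Bp Ap.
Qed.

Lemma unitary_fixingV p B : adj J = - J ->
  unitary_fixing p B -> unitary_fixing p (adj B).
Proof.
move=> aJ [B1 BJ Bp]; split; first by rewrite adjK// adjoint_inv.
  have := congr1 adj BJ; rewrite !adjM// aJ mulNr mulrN => /oppr_inj.
  by move=> e; rewrite /GRing.comm e.
by rewrite -{1}Bp mulrA B1 mul1r.
Qed.

Variables (K p P : 'M[R]_m.+1).
Hypothesis (KK : K * K = -1) (aK : adj K = - K).
Hypothesis (ap : adj p = p) (pp : p * p = p).
Hypothesis (Jp : GRing.comm J p) (Kp : GRing.comm K p).
Hypothesis kerE : ker_space P = [set v | p *m v = v].
Hypothesis imE : im_space P = [set v | p *m v = 0].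

Lemma kernel_splitting : orthogonal_splitting G (ker_space P) (im_space P).
Proof.
rewrite kerE imE; split=> [v|v w /= pv pw].
  exists (p *m v), ((1 - p) *m v); split=> /=.
  - by rewrite mulmxA [p *m p]pp.
  - by rewrite mulmxA [p *m _]mulrBr mulr1 pp subrr mul0mx.
  - by rewrite -mulmxDl addrC subrK mul1mx.
by rewrite -pv metric_adjl// ap pw /metric mulmx0 mxE.
Qed.

Lemma kernel_stable A : GRing.comm A p ->
  stable A (ker_space P) /\ stable A (im_space P).
Proof.
move=> Ap; rewrite kerE imE; split=> v /= pv.
  by rewrite mulmxA [p *m A](esym Ap) -mulmxA pv.
by rewrite mulmxA [p *m A](esym Ap) -mulmxA pv mulmx0.
Qed.

Lemma mx_eqP A B : (forall v : 'cV_m.+1, A *m v = B *m v) -> A = B.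
Proof.
move=> AB; apply: (metric_nondegenerate hG) => u v.
by rewrite AB.
Qed.

(** [C = 0] on the kernel already forces the skew operator [C] to preserve
    the orthogonal complement, and [[C, K]] to be skew and to anticommute with
    [K]. *)
Lemma distributionQSE (QS : 'M[R]_m.+1 -> 'M[R]_m.+1) : QS K = P ->
  distributionQS G J QS K = [set C * K - K * C | C in u_alg_fixing p].
Proof.
move=> QSK; apply/seteqP; split=> X /=; rewrite /distributionQS /= QSK kerE imE.
  move=> [_ [C [[/(so_algP hG) aC CJ] Cker _ ->]]]; exists C => //; split=> //.
    exact: subr0_eq.
  apply: mx_eqP => v; rewrite mul0mx -mulmxA Cker//=.
  by rewrite mulmxA [p *m p]pp.
move=> [C [aC CJ Cp] <-]; split.
  split; last first.
    rewrite /acomm -![_ *m _]/(_ * _) mulrBl mulrBr (mulrA K K) KK -(mulrA C) KK.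
    by rewrite mulrN1 mulN1r mulrA opprK addrA subrK addNr.
  apply/(so_algP hG); rewrite adjB !adjM// aC aK !mulrNN.
  by rewrite opprB.
exists C; split=> //.
- split; first exact/(so_algP hG).
  by rewrite /comm -![_ *m _]/(_ * _) CJ subrr.
- by move=> v /= <-; rewrite mulmxA [C *m p]Cp mul0mx.
move=> w /= pw; rewrite mulmxA [p *m C](_ : _ = 0) ?mul0mx//.
have := congr1 adj Cp; rewrite adjM// ap aC mulrN => /eqP.
by rewrite adjoint0 oppr_eq0 => /eqP.
Qed.

(** An isometry [A] of the image is completed by the identity on the kernel,
    [B = A (1 - p) + p], and conversely each [B] in the group restricts to the
    image. *)
Lemma leafQSE (QS : 'M[R]_m.+1 -> 'M[R]_m.+1) : QS K = P ->
  leafQS G J QS K = [set B * K * adj B | B in unitary_fixing p].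
Proof.
move=> QSK; apply/seteqP; split=> L /=; rewrite /leafQS /= /unitary_orbit_on QSK kerE imE.
  move=> [LK [A [A' [[Ast Ag AJ] _ A'A AA' LA]]]].
  have pr (v : 'cV[R]_m.+1) : p *m ((1 - p) *m v) = 0.
    by rewrite mulmxA [p *m _]mulrBr mulr1 pp subrr mul0mx.
  have pp' (v : 'cV[R]_m.+1) : p *m (p *m v) = p *m v by rewrite mulmxA [p *m p]pp.
  have LpE : L * p = K * p.
    by apply: mx_eqP => v; rewrite -!mulmxA LK//=.
  have pA : p * (A * (1 - p)) = 0.
    by apply: mx_eqP => v; rewrite mul0mx -!mulmxA; apply/Ast/pr.
  have AJ' : A * (1 - p) * J = J * (A * (1 - p)).
    apply: mx_eqP => v; rewrite -!mulmxA -AJ; last exact: pr.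
    congr (_ *m _); rewrite !mulmxA; congr (_ *m _).
    by rewrite [LHS]mulrBl [RHS]mulrBr mul1r mulr1 Jp.
  have AA : adj (1 - p) * (adj A * A) * (1 - p) = adj (1 - p) * (1 - p).
    apply: (metric_nondegenerate hG) => u v.
    have := Ag _ _ (pr u) (pr v); rewrite !metric_adjl//.
    by move: (adj A) (adj (1 - p)) => a b; rewrite !mulmxA mulrA.
  pose B := A * (1 - p) + p.
  have p1p : (1 - p) * p = 0 by rewrite mulrBl mul1r pp subrr.
  have Bp : B * p = p by rewrite mulrDl -mulrA p1p mulr0 add0r pp.
  have a1p : adj (1 - p) = 1 - p by rewrite adjB adjoint1// ap.
  have BB : adj B * B = 1.
    have aApp : adj (A * (1 - p)) * p = 0.
      by rewrite -[LHS](adjK hG) adjM// adjK// ap pA adjoint0.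
    have YY : adj (A * (1 - p)) * (A * (1 - p)) = 1 - p.
      rewrite adjM// mulrA -(mulrA _ (adj A)) AA a1p mulrBr mulr1 p1p.
      by rewrite subr0.
    rewrite /B; move: (A * (1 - p)) aApp pA YY => Y aYp pY YY.
    rewrite adjD ap mulrDl !mulrDr aYp pY YY addr0 add0r pp.
    by rewrite subrK.
  exists B.
    by split=> //; apply/commr_sym/commrD; [rewrite /GRing.comm AJ'|].
  suff BK : B * K = L * B by rewrite BK -mulrA adjoint_inv ?mulr1.
  rewrite /B [LHS]mulrDl [RHS]mulrDr LpE Kp; congr (_ + _).
  apply: mx_eqP => v; rewrite -!mulmxA LA; last by rewrite /= mulmxA -mulmxA; apply/Ast/pr.
  rewrite A'A; last exact: pr.
  congr (_ *m _); rewrite !mulmxA; congr (_ *m _).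
  by rewrite [LHS]mulrBl [RHS]mulrBr mul1r mulr1 Kp.
move=> [B [BB BJ Bp] <-].
have BB' := adjoint_inv BB.
have a1 : adj B * p = p by rewrite -{1}Bp mulrA BB mul1r.
have pB : p * B = p by rewrite -[LHS](adjK hG) adjM// ap a1.
have paB : p * adj B = p by rewrite -[LHS](adjK hG) adjM// adjK// ap Bp.
split=> [v /= pv|].
  rewrite -[in LHS]pv -[in RHS]pv !mulmxA; congr (_ *m _).
  by rewrite -![_ *m _]/(_ * _) -!mulrA a1 Kp mulrA Bp.
have aBJ : adj B * J = J * adj B.
  by rewrite -[LHS]mulr1 -BB' -mulrA (mulrA J) -BJ !mulrA BB mul1r.
have act C : GRing.comm C J -> p * C = p -> adj C * C = 1 ->
    unitary_on G J [set v | p *m v = 0] C.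
  move=> CJ pC CC; split=> [w /= pw|u v _ _|w _].
  - by rewrite mulmxA [p *m C]pC.
  - by rewrite metric_adjl// mulmxA [adj C *m C]CC mul1mx.
  - by rewrite !mulmxA [C *m J]CJ.
exists B, (adj B); split.
- exact: act.
- by apply: act => //; rewrite adjK.
- by move=> w _; rewrite mulmxA [adj B *m B]BB mul1mx.
- by move=> w _; rewrite mulmxA [B *m _]BB' mul1mx.
- by move=> w _; rewrite !mulmxA.
Qed.

End PointwiseDescription.

(** * Limits and derivatives of matrix-valued maps *)

Section MatrixCalculus.
Variable R : realType.

Section Filter.
Variables (T : Type) (F : set_system T).
Context {FF : Filter F}.

Lemma cvg_mx (p q : nat) (f : T -> 'M[R]_(p, q)) (A : 'M[R]_(p, q)) :
  (forall i j, f x i j @[x --> F] --> A i j) -> f x @[x --> F] --> A.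
Proof.
move=> fA U [W WA WU].
have : \forall x \near F, forall ij : 'I_p * 'I_q, W ij.1 ij.2 (f x ij.1 ij.2).
  by apply: filter_forall => -[i j]; exact: (fA i j _ (WA i j)).
by apply: filterS => x Wx; apply: WU => i j; exact: (Wx (i, j)).
Qed.

Lemma cvg_coord (p q : nat) (f : T -> 'M[R]_(p, q)) (A : 'M[R]_(p, q)) i j :
  f x @[x --> F] --> A -> f x i j @[x --> F] --> A i j.
Proof.
move=> fA.
exact: (@cvg_comp _ _ _ f (fun M : 'M[R]_(p, q) => M i j) _ _ _ fA
          (@coord_continuous R p q i j A)).
Qed.

Lemma cvg_mulmx (p q r : nat) (f : T -> 'M[R]_(p, q)) (g : T -> 'M[R]_(q, r))
    (A : 'M[R]_(p, q)) (B : 'M[R]_(q, r)) :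
  f x @[x --> F] --> A -> g x @[x --> F] --> B ->
  f x *m g x @[x --> F] --> A *m B.
Proof.
move=> fA gB; apply: cvg_mx => i j; rewrite mxE.
under eq_cvg do rewrite mxE.
by apply: (cvg_big add_continuous) => k _; apply: cvgM; exact: cvg_coord.
Qed.

Lemma cvg_det (n : nat) (f : T -> 'M[R]_n) (A : 'M[R]_n) :
  f x @[x --> F] --> A -> \det (f x) @[x --> F] --> \det A.
Proof.
move=> fA; rewrite /determinant; apply: (cvg_big add_continuous) => s _.
by apply: cvgM; [exact: cvg_cst|apply: (cvg_big mul_continuous) => i _; exact: cvg_coord].
Qed.

Lemma cvg_mxtrace (n : nat) (f : T -> 'M[R]_n) (A : 'M[R]_n) :
  f x @[x --> F] --> A -> \tr (f x) @[x --> F] --> \tr A.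
Proof.
move=> fA; rewrite /mxtrace; apply: (cvg_big add_continuous) => i _.
exact: cvg_coord.
Qed.

Lemma cvg_invmx (n : nat) (f : T -> 'M[R]_n) (A : 'M[R]_n) : A \in unitmx ->
  f x @[x --> F] --> A -> invmx (f x) @[x --> F] --> invmx A.
Proof.
move=> Au fA; have dA : \det A != 0 by rewrite -unitfE -unitmxE.
have df := cvg_det fA.
have dfu : \forall x \near F, f x \in unitmx.
  by apply: (filterS _ (cvgr_neq0 _ df dA)) => x; rewrite unitmxE unitfE.
(* Cramer's rule, valid where the determinant does not vanish. *)
apply: (@cvg_trans _ ((\det (f x))^-1 *: \adj (f x) @[x --> F])).
  apply: near_eq_cvg; apply: (filterS _ dfu) => x fu.
  by rewrite /invmx fu.
rewrite /invmx Au; apply: cvgZ; first exact: cvgV.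
apply: cvg_mx => i j; rewrite !mxE; under eq_cvg do rewrite !mxE.
apply: cvgM; first exact: cvg_cst.
apply: cvg_det; apply: cvg_mx => k l; rewrite !mxE; under eq_cvg do rewrite !mxE.
exact: cvg_coord.
Qed.

Lemma cvg_mulr (n : nat) (f g : T -> 'M[R]_n.+1) (A B : 'M[R]_n.+1) :
  f x @[x --> F] --> A -> g x @[x --> F] --> B ->
  f x * g x @[x --> F] --> A * B.
Proof. exact: cvg_mulmx. Qed.

End Filter.

Section Derive.
Variable V : normedModType R.

Lemma is_deriveE (W : normedModType R) (f : V -> W) x v df :
  is_derive x v f df <->
  h^-1 *: (f (h *: v + x) - f x) @[h --> 0^'] --> df.
Proof.
split=> [[fd <-]|fdf]; first exact: fd.
by split; [apply/cvg_ex; exists df|apply: cvg_lim].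
Qed.

Lemma is_derive_line (W : normedModType R) (f : V -> W) x v df :
  is_derive x v f df -> f (h *: v + x) @[h --> 0^'] --> f x.
Proof.
move=> /is_deriveE fd.
have : (h *: (h^-1 *: (f (h *: v + x) - f x)) + f x) @[h --> 0^'] --> 0 *: df + f x.
  apply: cvgD; last exact: cvg_cst.
  apply: cvgZ => //; exact: (@cvg_within _ (nbhs (0 : R))).
rewrite scale0r add0r; apply: cvg_trans; apply: near_eq_cvg.
near=> h; rewrite scalerA divff ?scale1r ?subrK//.
by near: h; exact: nbhs_dnbhs_neq.
Unshelve. all: by end_near. Qed.

Lemma is_derive_mulr (n : nat) (f g : V -> 'M[R]_n.+1) x v df dg :
  is_derive x v f df -> is_derive x v g dg ->
  is_derive x v (fun y => f y * g y) (df * g x + f x * dg).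
Proof.
move=> fd gd; have gc := is_derive_line gd.
move: fd gd => /is_deriveE fd /is_deriveE gd; apply/is_deriveE.
(* The Leibniz rule at the level of difference quotients. *)
pose q h := h^-1 *: (f (h *: v + x) - f x) * g (h *: v + x) +
            f x * (h^-1 *: (g (h *: v + x) - g x)).
apply: (@cvg_trans _ (q h @[h --> 0^'])); last first.
  by apply: cvgD; apply: cvg_mulr => //; exact: cvg_cst.
apply: near_eq_cvg; near=> h; rewrite /q -scalerAl -scalerAr -scalerDr.
by rewrite mulrBl mulrBr subrKA.
Unshelve. all: by end_near. Qed.

(** The derivative of the inverse, from
    [A^-1 - B^-1 = A^-1 (B - A) B^-1]. *)
Lemma is_derive_invmx (n : nat) (f : V -> 'M[R]_n.+1) x v df :
  (forall y, f y \is a GRing.unit) -> is_derive x v f df ->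
  is_derive x v (fun y => (f y)^-1) (- ((f x)^-1 * df * (f x)^-1)).
Proof.
move=> fu fd; have fc := is_derive_line fd.
move: fd => /is_deriveE fd; apply/is_deriveE.
pose q h := - ((f (h *: v + x))^-1 * (h^-1 *: (f (h *: v + x) - f x)) * (f x)^-1).
apply: (@cvg_trans _ (q h @[h --> 0^'])); last first.
  apply: cvgN; apply: cvg_mulr; last exact: cvg_cst.
  by apply: cvg_mulr => //; apply: cvg_invmx => //; exact: fu.
apply: near_eq_cvg; near=> h; rewrite /q -scalerAr -scalerAl -scalerN; congr (_ *: _).
rewrite mulrBr mulrBl mulVr// mul1r -mulrA mulrV// mulr1.
by rewrite opprB.
Unshelve. all: by end_near. Qed.

Lemma is_derive_coord (p q : nat) (f : V -> 'M[R]_(p, q)) x v df i j :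
  is_derive x v f df -> is_derive x v (fun y => f y i j) (df i j).
Proof.
move=> /is_deriveE fd; apply/is_deriveE.
have := cvg_coord (i := i) (j := j) fd.
by under eq_cvg do rewrite !mxE; apply.
Qed.

Lemma is_derive_mxtrace (n : nat) (f : V -> 'M[R]_n) x v df :
  is_derive x v f df -> is_derive x v (fun y => \tr (f y)) (\tr df).
Proof.
move=> /is_deriveE fd; apply/is_deriveE.
have := cvg_mxtrace fd.
by under eq_cvg do rewrite linearZ linearB /=; apply.
Qed.

End Derive.

Lemma is_derive0_cst (f : R -> R) :
  (forall t : R, t \in `[0 : R, 1]%R -> is_derive t 1 f 0) ->
  forall t : R, t \in `[0 : R, 1]%R -> f t = f 0.
Proof.
move=> fd t /[dup] t01; rewrite in_itv/= => /andP[t0 t1].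
have sub s : s \in `[0, t]%R -> s \in `[0 : R, 1]%R.
  by rewrite !in_itv/= => /andP[-> /le_trans]; apply.
have fdt (s : R) : s \in `]0, t[%R -> is_derive s 1 f ((fun=> 0) s).
  by move=> st; apply/fd/sub; apply: subset_itvW st.
have fc : {within `[0, t], continuous f}.
  by apply: derivable_within_continuous => s st; have [] := fd s (sub s st).
have [c _] := MVT_segment t0 fdt fc.
by rewrite mul0r => /subr0_eq.
Qed.

End MatrixCalculus.

(** * The Cayley transform *)

Section Cayley.
Variables (R : realType) (m : nat) (G J : 'M[R]_m.+1).
Hypothesis hG : is_metric G.
Local Notation adj := (adjoint G).
Implicit Types (A B C K X Y Z p : 'M[R]_m.+1).

Lemma unit_of_mul_eq0 B : (forall A, B * A = 0 -> A = 0) -> B \is a GRing.unit.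
Proof.
move=> Binj; rewrite -[_ \is a _]/(B \in unitmx) -row_full_unit -cokermx_eq0.
by apply/eqP/Binj; rewrite [B * _]mulmx_coker.
Qed.

(** [X A = A] makes [A^* A = A^* X A] both symmetric and skew. *)
Lemma skew_unit X : adj X = - X -> 1 - X \is a GRing.unit.
Proof.
move=> aX; apply: unit_of_mul_eq0 => A; rewrite mulrBl mul1r => /subr0_eq AX.
apply: (adjM_eq0 hG).
have NE : adj A * A = adj A * X * A by rewrite -mulrA -AX.
have := congr1 adj NE; rewrite !adjM// adjK// aX mulNr mulrN mulrA -NE => /eqP.
by rewrite -addr_eq0 -mulr2n -scaler_nat scaler_eq0 pnatr_eq0 => /eqP.
Qed.

(** The Cayley transform [(1 + X) (1 - X)^-1], in a form in which [X] occurs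
    once. *)
Definition cayley X : 'M[R]_m.+1 := 2 *: (1 - X)^-1 - 1.

Section Skew.
Variable X : 'M[R]_m.+1.
Hypothesis aX : adj X = - X.

Lemma skew_unitN : 1 + X \is a GRing.unit.
Proof. by rewrite -[X]opprK; apply: skew_unit; rewrite adjN aX. Qed.

(** The partial fraction decomposition of [2 / (1 - X^2)], from which all the
    identities between Cayley transforms and resolvents follow. *)
Lemma cayley_inv_add :
  (1 - X)^-1 + (1 + X)^-1 = 2 *: ((1 - X)^-1 * (1 + X)^-1).
Proof.
have uX := skew_unit aX; have vX := skew_unitN.
have two : (1 + X) + (1 - X) = 2 *: 1 by rewrite addrACA subrr addr0 scaler_nat.
have : (1 - X)^-1 * ((1 + X) + (1 - X)) * (1 + X)^-1
       = 2 *: ((1 - X)^-1 * (1 + X)^-1).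
  by rewrite two -scalerAr mulr1 scalerAl.
rewrite mulrDr mulVr// mulrDl mul1r -[_ * (1 + X) * _]mulrA mulrV// mulr1.
exact.
Qed.

Lemma cayley_mulN : cayley X * cayley (- X) = 1.
Proof.
rewrite /cayley opprK mulrBl mulrBr mul1r mulr1.
rewrite -scalerAl -scalerAr -cayley_inv_add scalerDr opprB.
by rewrite (addrC (2 *: _)) addrK addrC subrK.
Qed.

Lemma cayley_mul_inv : cayley X * (1 + X)^-1 = (1 - X)^-1.
Proof.
rewrite /cayley mulrBl mul1r -scalerAl -cayley_inv_add.
by rewrite addrK.
Qed.

Lemma adj_resolvent : adj (1 - X)^-1 = (1 + X)^-1.
Proof.
have uX := skew_unit aX; have vX := skew_unitN.
have e : adj (1 - X) = 1 + X by rewrite adjB adjoint1// aX opprK.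
by apply: (mulIr vX); rewrite mulVr// -{1}e -adjM// mulrV// adjoint1.
Qed.

Lemma adj_cayley : adj (cayley X) = cayley (- X).
Proof.
by rewrite /cayley opprK adjB adjZ adjoint1// adj_resolvent.
Qed.

End Skew.

Lemma cayley_mul_invN X : adj X = - X -> (1 - X)^-1 * cayley (- X) = (1 + X)^-1.
Proof.
move=> aX; rewrite /cayley opprK mulrBr mulr1 -scalerAr -cayley_inv_add//.
by rewrite addrAC subrr add0r.
Qed.

Lemma cayley_unitary p X :
  u_alg_fixing G J p X -> unitary_fixing G J p (cayley X).
Proof.
move=> [aX XJ Xp]; split.
- have aNX : adj (- X) = - - X by rewrite adjN aX.
  by rewrite adj_cayley// -{2}[X]opprK cayley_mulN.
- apply/commr_sym; apply: commrB; last exact: commr1.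
  rewrite /GRing.comm -scalerAl -scalerAr; congr (_ *: _).
  apply: commrV; apply: commrB; first exact: commr1.
  exact/commr_sym.
- have -> : cayley X * p = 2 *: ((1 - X)^-1 * p) - p by rewrite mulrBl mul1r scalerAl.
  have -> : (1 - X)^-1 * p = p.
    apply: (mulrI (skew_unit aX)); rewrite mulrA mulrV ?skew_unit// mul1r.
    by rewrite mulrBl mul1r Xp subr0.
  by rewrite scaler_nat mulr2n addrK.
Qed.

(** With [X = X(t)] and [Z] its velocity, [2 (1 + X)^-1 Z (1 - X)^-1] is the
    logarithmic derivative of the Cayley transform; it stays in the Lie
    algebra. *)
Lemma u_alg_fixing_cayley p X Z : adj p = p ->
  u_alg_fixing G J p X -> u_alg_fixing G J p Z ->
  u_alg_fixing G J p ((1 + X)^-1 * Z * (1 - X)^-1).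
Proof.
move=> ap [aX XJ Xp] [aZ ZJ Zp].
have uX := skew_unit aX; have vX := skew_unitN aX.
have aV := adj_resolvent aX.
split.
- by rewrite !adjM// aV aZ -[(1 + X)^-1]aV adjK// mulNr mulrN mulrA.
- apply/commr_sym; apply: commrM; first apply: commrM.
  + by apply/commrV/commrD; [exact: commr1|exact/commr_sym].
  + exact/commr_sym.
  + by apply/commrV/commrB; [exact: commr1|exact/commr_sym].
- have up : (1 - X)^-1 * p = p.
    apply: (mulrI uX); rewrite mulrA mulrV// mul1r.
    by rewrite mulrBl mul1r Xp subr0.
  by rewrite -!mulrA up Zp mulr0.
Qed.

End Cayley.

(** * Smoothness of the Cayley charts *)

Section SmoothMaps.
Variables (R : realType) (V : normedModType R) (n : nat).
Implicit Types (f g : V -> 'M[R]_n.+1).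

Lemma Ck_restrict (W : normedModType R) (f : V -> W) k (U : set V) :
  Ck k setT f -> Ck k U f.
Proof.
elim: k f => [|k IHk] f /=; first by move=> fc x _; apply: fc; rewrite inE.
move=> [fc fd]; split; first by move=> x _; apply: fc; rewrite inE.
by move=> v; have [dv Dv] := fd v; split=> [x _|]; [exact: dv|exact: IHk].
Qed.

Lemma Ck_pred (W : normedModType R) (f : V -> W) k : Ck k.+1 setT f -> Ck k setT f.
Proof.
elim: k f => [|k IHk] f; first by case.
by move=> [fc fd]; split=> // v; have [dv Dv] := fd v; split=> //; exact: IHk.
Qed.

Lemma Ck_succ (W : normedModType R) (f : V -> W) (df : V -> V -> W) k :
  (forall x, {for x, continuous f}) ->
  (forall x v, is_derive x v f (df v x)) -> (forall v, Ck k setT (df v)) ->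
  Ck k.+1 setT f.
Proof.
move=> fc fd dfC; split=> [x _|v]; first exact: fc.
split=> [x _|]; first by have [] := fd x v.
rewrite (_ : (fun x => 'D_v f x) = df v); first exact: dfC.
by apply/funext => x; have [] := fd x v.
Qed.

Lemma CkS_inv (W : normedModType R) (f : V -> W) k : Ck k.+1 setT f ->
  [/\ forall x, {for x, continuous f}, forall x v, is_derive x v f ('D_v f x) &
      forall v, Ck k setT (fun x => 'D_v f x)].
Proof.
move=> [fc fd]; split=> [x|x v|v].
- by apply: fc; rewrite inE.
- by apply/derivableP; have [dv _] := fd v; exact: dv.
- by have [_] := fd v.
Qed.

Lemma Ck_cst (W : normedModType R) k (w : W) : Ck k setT (fun _ : V => w).
Proof.
elim: k w => [|k IHk] w; first by move=> x _; exact: cvg_cst.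
apply: (Ck_succ (df := fun _ _ => 0)) => [x|v]; last exact: (IHk 0).
exact: cvg_cst.
Qed.

Lemma CkD k f g : Ck k setT f -> Ck k setT g -> Ck k setT (fun x => f x + g x).
Proof.
elim: k f g => [|k IHk] f g.
  by move=> fc gc x xT; apply: cvgD; [exact: fc|exact: gc].
move=> /CkS_inv[fc fd fC] /CkS_inv[gc gd gC].
apply: (Ck_succ (df := fun v x => 'D_v f x + 'D_v g x)) => [x|v].
  by apply: cvgD; [exact: fc|exact: gc].
exact: IHk.
Qed.

Lemma CkM k f g : Ck k setT f -> Ck k setT g -> Ck k setT (fun x => f x * g x).
Proof.
elim: k f g => [|k IHk] f g.
  by move=> fc gc x xT; apply: cvg_mulr; [exact: fc|exact: gc].
move=> fC0 gC0; have [fc fd fC] := CkS_inv fC0; have [gc gd gC] := CkS_inv gC0.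
apply: (Ck_succ (df := fun v x => 'D_v f x * g x + f x * 'D_v g x)) => [x|x v|v].
- by apply: cvg_mulr; [exact: fc|exact: gc].
- exact: is_derive_mulr.
- by apply: CkD; apply: IHk => //; exact: Ck_pred.
Qed.

(** The derivative of [f^-1] is a polynomial in [f^-1] and the derivative of
    [f], so that the order of differentiability increases by induction. *)
Lemma CkV k f : (forall x, f x \is a GRing.unit) ->
  Ck k setT f -> Ck k setT (fun x => (f x)^-1).
Proof.
move=> fu; elim: k => [|k IHk].
  by move=> fc x xT; apply: cvg_invmx; [exact: fu|exact: fc].
move=> fC0; have [fc fd fC] := CkS_inv fC0.
apply: (Ck_succ (df := fun v x => -1 * ((f x)^-1 * 'D_v f x * (f x)^-1))).
- by move=> x; apply: cvg_invmx; [exact: fu|exact: fc].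
- by move=> x v; rewrite mulN1r; exact: is_derive_invmx.
- have fVC := IHk (Ck_pred fC0).
  by move=> v; apply: CkM; [exact: Ck_cst|apply: CkM => //; exact: CkM].
Qed.

End SmoothMaps.

Section Chart.
Variables (R : realType) (m : nat) (G J K1 p : 'M[R]_m.+1).
Hypothesis hG : is_metric G.
Hypothesis ap : adjoint G p = p.
Local Notation adj := (adjoint G).
Implicit Types (A B X Y Z : 'M[R]_m.+1).

Lemma u_alg_fixing0 : u_alg_fixing G J p 0.
Proof. by split; rewrite ?adjoint0 ?oppr0 ?mul0r//; apply/commr_sym/commr0. Qed.

Lemma u_alg_fixingD X Y : u_alg_fixing G J p X -> u_alg_fixing G J p Y ->
  u_alg_fixing G J p (X + Y).
Proof.
move=> [aX XJ Xp] [aY YJ Yp]; split.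
- by rewrite adjD aX aY opprD.
- by apply/commr_sym/commrD; exact/commr_sym.
- by rewrite mulrDl Xp Yp addr0.
Qed.

Lemma u_alg_fixingZ a X : u_alg_fixing G J p X -> u_alg_fixing G J p (a *: X).
Proof.
move=> [aX XJ Xp]; split.
- by rewrite adjZ aX scalerN.
- by rewrite /GRing.comm -scalerAl -scalerAr XJ.
- by rewrite -scalerAl Xp scaler0.
Qed.

Variables (d : nat) (C : 'I_d -> 'M[R]_m.+1).
Hypothesis CP : forall i, u_alg_fixing G J p (C i).

Definition combo (x : 'rV[R]_d) : 'M[R]_m.+1 := \sum_i x 0 i *: C i.

Lemma comboD x y : combo (x + y) = combo x + combo y.
Proof.
by rewrite /combo -big_split; apply: eq_bigr => i _; rewrite mxE scalerDl.
Qed.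

Lemma comboZ a x : combo (a *: x) = a *: combo x.
Proof.
by rewrite /combo scaler_sumr; apply: eq_bigr => i _; rewrite mxE scalerA.
Qed.

Lemma comboB x y : combo (x - y) = combo x - combo y.
Proof. by rewrite -scaleN1r comboD comboZ scaleN1r. Qed.

Lemma combo_alg x : u_alg_fixing G J p (combo x).
Proof.
apply: big_ind; [exact: u_alg_fixing0|exact: u_alg_fixingD|].
by move=> i _; apply: u_alg_fixingZ.
Qed.

Lemma adj_combo x : adj (combo x) = - combo x.
Proof. by have [] := combo_alg x. Qed.

Lemma continuous_combo : continuous combo.
Proof.
apply: (continuous_big add_continuous) => i _ x.
exact: (cvgZ (@coord_continuous R 1 d 0 i x) (cvg_cst _)).
Qed.

Lemma is_derive_combo x v : is_derive x v combo (combo v).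
Proof.
apply/is_deriveE; apply: (@cvg_trans _ ((fun=> combo v) h @[h --> (0 : R)^'])).
  apply: near_eq_cvg; near=> h; rewrite comboD comboZ addrK scalerA mulVf ?scale1r//.
  by near: h; exact: nbhs_dnbhs_neq.
exact: cvg_cst.
Unshelve. all: by end_near. Qed.

Lemma Ck_combo k : Ck k setT combo.
Proof.
case: k => [|k]; first by move=> x _; exact: continuous_combo.
apply: (Ck_succ (df := fun v _ => combo v)) => [x|x v|v].
- exact: continuous_combo.
- exact: is_derive_combo.
- exact: Ck_cst.
Qed.

(** The orbit map at [K1] composed with the Cayley transform, a rational
    substitute for the exponential map whose difference quotients are
    explicit. *)
Definition chart (x : 'rV[R]_d) : 'M[R]_m.+1 :=
  cayley (combo x) * K1 * cayley (- combo x).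

(** The difference quotient of [chart]: its value on the diagonal is the
    differential, so that its injectivity near the origin makes [chart] at once
    injective and immersive. *)
Definition chart_slope (x y z : 'rV[R]_d) : 'M[R]_m.+1 :=
  2 *: ((1 - combo x)^-1 * combo z * (1 - combo y)^-1 * K1 * cayley (- combo x))
  - 2 *: (cayley (combo y) * K1 * ((1 + combo x)^-1 * combo z * (1 + combo y)^-1)).

Lemma resolventB A B : A \is a GRing.unit -> B \is a GRing.unit ->
  A^-1 - B^-1 = A^-1 * (B - A) * B^-1.
Proof.
move=> Au Bu; rewrite mulrBr mulrBl mulVr// mul1r -mulrA mulrV// mulr1.
by [].
Qed.

Lemma chart_sub x y : chart x - chart y = chart_slope x y (x - y).
Proof.
have ux := skew_unit hG (adj_combo x); have uy := skew_unit hG (adj_combo y).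
have vx := skew_unitN hG (adj_combo x); have vy := skew_unitN hG (adj_combo y).
rewrite /chart /chart_slope comboB.
have cE : cayley (combo x) - cayley (combo y) =
    2 *: ((1 - combo x)^-1 * (combo x - combo y) * (1 - combo y)^-1).
  rewrite /cayley opprB addrA subrK -scalerBr resolventB//.
  by congr (_ *: (_ * _ * _)); rewrite opprD addrACA subrr add0r opprK addrC.
have cNE : cayley (- combo x) - cayley (- combo y) =
    - (2 *: ((1 + combo x)^-1 * (combo x - combo y) * (1 + combo y)^-1)).
  rewrite /cayley !opprK opprB addrA subrK -scalerBr resolventB//.
  by rewrite opprD addrACA subrr add0r -opprB mulrN mulNr scalerN.
have -> : forall a b c e : 'M[R]_m.+1,
    a * K1 * c - b * K1 * e = (a - b) * K1 * c + b * K1 * (c - e).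
  by move=> a b c e; rewrite !mulrBl mulrBr subrKA.
by rewrite cE cNE mulrN -!scalerAl -scalerAr.
Qed.

Lemma is_derive_cayley x v : is_derive x v (fun y => cayley (combo y))
  (2 *: ((1 - combo x)^-1 * combo v * (1 - combo x)^-1)).
Proof.
have u y : 1 - combo y \is a GRing.unit by apply: (skew_unit hG (adj_combo y)).
have d1 : is_derive x v (fun y => 1 - combo y) (0 - combo v).
  by have dc := is_derive_combo x v; apply: is_deriveB.
have := is_derive_invmx u d1; rewrite sub0r mulrN mulNr opprK => d2.
rewrite -[X in is_derive _ _ _ X]subr0.
exact: is_deriveB.
Qed.

Lemma is_derive_cayleyN x v : is_derive x v (fun y => cayley (- combo y))
  (- (2 *: ((1 + combo x)^-1 * combo v * (1 + combo x)^-1))).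
Proof.
have u y : 1 - - combo y \is a GRing.unit.
  by rewrite opprK; apply: (skew_unitN hG (adj_combo y)).
have d1 : is_derive x v (fun y => 1 - - combo y) (0 - - combo v).
  by have dc := is_derive_combo x v; apply: is_deriveB.
have := is_derive_invmx u d1; rewrite sub0r !opprK => d2.
rewrite -[X in is_derive _ _ _ X]subr0 -scalerN.
exact: is_deriveB.
Qed.

Lemma is_derive_chart x v : is_derive x v chart (chart_slope x x v).
Proof.
have d1 := is_derive_cayley x v; have d2 := is_derive_cayleyN x v.
have d3 := is_derive_mulr (is_derive_mulr d1 (is_derive_cst K1 x v)) d2.
apply: is_derive_eq d3 _.
by rewrite mulr0 addr0 mulrN -!scalerAl -scalerAr.
Qed.

Lemma smooth_chart (U : set 'rV[R]_d) : smooth_on U chart.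
Proof.
move=> k; apply: Ck_restrict.
have C1 (s : R) : Ck k setT (fun x => 1 + (s *: 1) * combo x).
  by apply: CkD; [exact: Ck_cst|apply: CkM; [exact: Ck_cst|exact: Ck_combo]].
have cC (s : R) : s = 1 \/ s = -1 -> Ck k setT (fun x => cayley (s *: combo x)).
  move=> s1.
  have -> : (fun x => cayley (s *: combo x)) =
     (fun x => (2 *: 1) * (1 + ((- s) *: 1) * combo x)^-1 + (-1)).
    apply/funext => x; rewrite /cayley -!scalerAl !mul1r scaleNr.
    by [].
  apply: CkD; last exact: Ck_cst.
  apply: CkM; first exact: Ck_cst.
  apply: CkV => // x; rewrite -scalerAl mul1r.
  case: s1 => ->; first by rewrite scaleN1r; apply: (skew_unit hG (adj_combo x)).
  by rewrite opprK scale1r; apply: (skew_unitN hG (adj_combo x)).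
have cP : Ck k setT (fun x => cayley (combo x)).
  have /cC : (1 : R) = 1 \/ (1 : R) = -1 by left.
  by under eq_fun do rewrite scale1r.
have cN : Ck k setT (fun x => cayley (- combo x)).
  have /cC : (-1 : R) = 1 \/ (-1 : R) = -1 by right.
  by under eq_fun do rewrite scaleN1r.
apply: CkM cN; apply: CkM cP _; exact: Ck_cst.
Qed.

Lemma continuous_chart : continuous chart.
Proof. by move=> x; have := smooth_chart setT 0%N; apply; rewrite inE. Qed.

(** With [B] the Cayley transform, the differential is [B [2 Z, K1] B^-1], which
    is the bracket of [2 B Z B^-1] with the value of the chart; so it takes
    values in the distribution. *)
Lemma chart_slope_diag x v :
  let Z := (1 + combo x)^-1 * combo v * (1 - combo x)^-1 in
  chart_slope x x v =
    cayley (combo x) * (2 *: (Z * K1 - K1 * Z)) * cayley (- combo x).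
Proof.
have a := adj_combo x; rewrite /= /chart_slope.
rewrite -scalerAr -scalerAl -scalerBr; congr (_ *: _).
move: (cayley_mul_inv hG a) (cayley_mul_invN hG a).
move: (cayley (combo x)) (cayley (- combo x)) => u w ub aw.
by rewrite mulrBr mulrBl !mulrA ub -!mulrA aw.
Qed.

Lemma chart_unitary x :
  unitary_fixing G J p (cayley (combo x)) /\
  adj (cayley (combo x)) = cayley (- combo x).
Proof.
by split; [apply: cayley_unitary => //; exact: combo_alg
          |rewrite adj_cayley//; exact: adj_combo].
Qed.

End Chart.

(** * Frames of the distribution and regularity of the charts *)

(** The brackets with [K] form a basis of the distribution at [K], whence [d] is
    the dimension of the leaf. *)
Definition bracket_frame (R : realType) (m : nat) (G J p K : 'M[R]_m.+1) d
    (C : 'I_d -> 'M[R]_m.+1) :=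
  [/\ forall i, u_alg_fixing G J p (C i),
      forall x, combo C x * K - K * combo C x = 0 -> x = 0 &
      forall Z, u_alg_fixing G J p Z ->
        exists x, Z * K - K * Z = combo C x * K - K * combo C x].

Section BracketBasis.
Variables (R : realType) (m : nat) (G J K1 p : 'M[R]_m.+1).
Hypothesis hG : is_metric G.
Local Notation bracket Z := (Z * K1 - K1 * Z).

Lemma bracket_combo d (C : 'I_d -> 'M[R]_m.+1) x :
  bracket (combo C x) = \sum_i x 0 i *: bracket (C i).
Proof.
rewrite /combo mulr_suml mulr_sumr -sumrB; apply: eq_bigr => i _.
by rewrite -scalerAl -scalerAr scalerBr.
Qed.

(** A maximal family whose brackets with [K1] are independent. *)
Lemma bracket_basis : exists d (C : 'I_d -> 'M[R]_m.+1), bracket_frame G J p K1 C.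
Proof.
pose br (Z : 'M[R]_m.+1) := bracket Z.
pose P n := `[< exists s : seq 'M[R]_m.+1, [/\ size s = n,
  forall Z, Z \in s -> u_alg_fixing G J p Z & free (map br s)] >].
have P0 : exists n, P n.
  by exists 0%N; apply/asboolP; exists [::]; split=> //; rewrite /= nil_free.
have Pbound n : P n -> (n <= \dim {:'M[R]_m.+1})%N.
  move=> /asboolP[s [<- _ sfree]]; rewrite -(size_map br).
  by move: sfree; rewrite /free => /eqP <-; apply/dimvS/subvf.
have [d /asboolP[s [sd sP sfree]] dmax] := ex_maxnP P0 Pbound.
pose X := in_tuple (map br s).
have Xd : size (map br s) = d by rewrite size_map.
exists d, (fun i => s`_i); split.
- by move=> i; apply/sP; apply: mem_nth; rewrite /= sd.
- move=> x; rewrite bracket_combo => x0.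
  pose X' := Tuple (introT eqP Xd); have /freeP X'free : free X' by [].
  apply/rowP => i; rewrite mxE; apply: X'free; rewrite -[RHS]x0.
  by apply: eq_bigr => j _; rewrite (nth_map 0) ?sd.
move=> Z hZ; pose X' := Tuple (introT eqP Xd).
have : br Z \in <<X'>>%VS.
  apply/negPn/negP => Zs; have : P d.+1; last by move/dmax; rewrite ltnn.
  apply/asboolP; exists (Z :: s); split; first by rewrite /= sd.
    by move=> Y; rewrite inE => /predU1P[->|/sP].
  by rewrite /= free_cons sfree andbT.
move=> /coord_span brE; exists (\row_i coord X' i (br Z)).
rewrite bracket_combo -[LHS]/(br Z) {1}brE; apply: eq_bigr => i _.
by rewrite mxE /= (nth_map 0) ?sd.
Qed.

End BracketBasis.

Section RegularChart.
Variables (R : realType) (m : nat) (G J K1 p : 'M[R]_m.+1).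
Hypothesis hG : is_metric G.
Hypothesis ap : adjoint G p = p.
Variables (d : nat) (C : 'I_d -> 'M[R]_m.+1).
Hypothesis CP : forall i, u_alg_fixing G J p (C i).
Hypothesis Cinj :
  forall x, combo C x * K1 - K1 * combo C x = 0 -> x = 0.
Local Notation slope := (chart_slope K1 C).

Lemma slopeD x y z w : slope x y (z + w) = slope x y z + slope x y w.
Proof.
rewrite /chart_slope comboD.
move: (1 - combo C x)^-1 (1 - combo C y)^-1 (cayley (- combo C x)) => a b c.
move: (cayley (combo C y)) (1 + combo C x)^-1 (1 + combo C y)^-1 => e f g.
by rewrite !(mulrDr, mulrDl) !scalerDr opprD addrACA.
Qed.

Lemma slopeZ x y t z : slope x y (t *: z) = t *: slope x y z.
Proof.
rewrite /chart_slope comboZ.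
move: (1 - combo C x)^-1 (1 - combo C y)^-1 (cayley (- combo C x)) => a b c.
move: (cayley (combo C y)) (1 + combo C x)^-1 (1 + combo C y)^-1 => e f g.
by rewrite !(=^~ scalerAr, =^~ scalerAl) scalerBr !scalerA !(mulrC t).
Qed.

Lemma slope_sum x y z : slope x y z = \sum_i z 0 i *: slope x y (delta_mx 0 i).
Proof.
have slope0 : slope x y 0 = 0 by rewrite -(scale0r 0) slopeZ !scale0r.
rewrite {1}[z]row_sum_delta (big_morph (slope x y) (slopeD x y) slope0).
by apply: eq_bigr => i _; rewrite slopeZ.
Qed.

Lemma combo0 : combo C 0 = 0.
Proof. by rewrite -(scale0r 0) comboZ scale0r. Qed.

Lemma cayley0 : cayley (0 : 'M[R]_m.+1) = 1.
Proof. by rewrite /cayley subr0 invr1 scaler_nat mulr2n addrK. Qed.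

Lemma slope0 z : slope 0 0 z = 2 *: (combo C z * K1 - K1 * combo C z).
Proof.
rewrite /chart_slope combo0 subr0 addr0 oppr0 cayley0 invr1 !(mulr1, mul1r).
by rewrite scalerBr.
Qed.

Let slope_mx x y : 'M[R]_(d, m.+1 * m.+1) :=
  \matrix_i mxvec (slope x y (delta_mx 0 i)).

Let slope_mxE x y z : z *m slope_mx x y = mxvec (slope x y z).
Proof.
rewrite slope_sum linear_sum mulmx_sum_row; apply: eq_bigr => i _.
by rewrite rowK linearZ.
Qed.

Lemma cvg_slope (T : Type) (F : set_system T) (FF : Filter F)
    (f g : T -> 'rV[R]_d) (x y z : 'rV[R]_d) :
  f t @[t --> F] --> x -> g t @[t --> F] --> y ->
  slope (f t) (g t) z @[t --> F] --> slope x y z.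
Proof.
move=> fx gy.
have c1 : combo C (f t) @[t --> F] --> combo C x.
  by apply: (cvg_comp _ _ fx); exact: continuous_combo.
have c2 : combo C (g t) @[t --> F] --> combo C y.
  by apply: (cvg_comp _ _ gy); exact: continuous_combo.
have u w : 1 - combo C w \in unitmx := skew_unit hG (adj_combo CP w).
have v w : 1 + combo C w \in unitmx := skew_unitN hG (adj_combo CP w).
have cst (A : 'M[R]_m.+1) : A @[t --> F] --> A by exact: cvg_cst.
have two (h : T -> 'M[R]_m.+1) (A : 'M[R]_m.+1) : h t @[t --> F] --> A ->
    2 *: h t @[t --> F] --> 2 *: A.
  by move=> hA; apply: cvgZ => //; exact: cvg_cst.
have i1 : (1 - combo C (f t))^-1 @[t --> F] --> (1 - combo C x)^-1.
  exact: (cvg_invmx (u x) (cvgB (cst 1) c1)).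
have i2 : (1 - combo C (g t))^-1 @[t --> F] --> (1 - combo C y)^-1.
  exact: (cvg_invmx (u y) (cvgB (cst 1) c2)).
have j1 : (1 + combo C (f t))^-1 @[t --> F] --> (1 + combo C x)^-1.
  exact: (cvg_invmx (v x) (cvgD (cst 1) c1)).
have j2 : (1 + combo C (g t))^-1 @[t --> F] --> (1 + combo C y)^-1.
  exact: (cvg_invmx (v y) (cvgD (cst 1) c2)).
have k1 : cayley (- combo C (f t)) @[t --> F] --> cayley (- combo C x).
  rewrite /cayley opprK; under eq_cvg do rewrite opprK.
  exact: (cvgB (two _ _ j1) (cst 1)).
have k2 : cayley (combo C (g t)) @[t --> F] --> cayley (combo C y).
  exact: (cvgB (two _ _ i2) (cst 1)).
have s1 : (1 - combo C (f t))^-1 * combo C z * (1 - combo C (g t))^-1 * K1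
      * cayley (- combo C (f t)) @[t --> F] -->
    (1 - combo C x)^-1 * combo C z * (1 - combo C y)^-1 * K1
      * cayley (- combo C x).
  exact: (cvg_mulr (cvg_mulr (cvg_mulr (cvg_mulr i1 (cst _)) i2) (cst _)) k1).
have s2 : cayley (combo C (g t)) * K1
      * ((1 + combo C (f t))^-1 * combo C z * (1 + combo C (g t))^-1) @[t --> F] -->
    cayley (combo C y) * K1
      * ((1 + combo C x)^-1 * combo C z * (1 + combo C y)^-1).
  exact: (cvg_mulr (cvg_mulr k2 (cst _)) (cvg_mulr (cvg_mulr j1 (cst _)) j2)).
exact: (cvgB (two _ _ s1) (two _ _ s2)).
Qed.

Let cvg_slope_mx (T : Type) (F : set_system T) (FF : Filter F)
    (f g : T -> 'rV[R]_d) (x y : 'rV[R]_d) (W : 'M[R]_(m.+1 * m.+1, d)) :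
  f t @[t --> F] --> x -> g t @[t --> F] --> y ->
  \det (slope_mx (f t) (g t) *m W) @[t --> F] --> \det (slope_mx x y *m W).
Proof.
move=> fx gy; apply: cvg_det; apply: cvg_mulmx; last exact: cvg_cst.
apply: cvg_mx => i; case/mxvec_indexP => a b.
have E u v : slope_mx u v i (mxvec_index a b) = slope u v (delta_mx 0 i) a b.
  by rewrite mxE mxvecE.
rewrite E (funext (fun t => E (f t) (g t))).
by apply: cvg_coord; apply: cvg_slope.
Qed.

(** Having full rank is an open condition. *)
Lemma slope_injective_near : exists2 r : R, 0 < r &
  forall x y, ball 0 r x -> ball 0 r y -> forall z, slope x y z = 0 -> z = 0.
Proof.
have free0 : row_free (slope_mx 0 0).
  apply: inj_row_free => z; rewrite slope_mxE => /eqP; rewrite mxvec_eq0 slope0.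
  by rewrite scaler_eq0 pnatr_eq0 => /eqP; exact: Cinj.
have /row_freeP[W W1] := free0.
have cdet : \det (slope_mx xy.1 xy.2 *m W)
    @[xy --> nbhs (0 : 'rV[R]_d, 0 : 'rV[R]_d)] --> (1 : R).
  rewrite -(det1 R d) -W1; apply: (@cvg_slope_mx _ _ (nbhs_filter _)).
    exact: cvg_fst.
  exact: cvg_snd.
have near0 : nbhs (0 : 'rV[R]_d, 0 : 'rV[R]_d)
    [set xy | \det (slope_mx xy.1 xy.2 *m W) != 0].
  exact: (@cvgr_neq0 _ _ _ _ (nbhs_filter _) _ _ cdet (oner_neq0 R)).
have [r /= r0 rP] := (nbhs_ballP _ _).1 near0.
exists r => // x y xr yr z sz.
have := rP (x, y) (conj xr yr); rewrite /= -unitfE -unitmxE => u.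
have : z *m (slope_mx x y *m W) = 0 by rewrite mulmxA slope_mxE sz linear0 mul0mx.
by move=> /(congr1 (mulmx^~ (invmx (slope_mx x y *m W)))); rewrite mulmxK// mul0mx.
Qed.

End RegularChart.

(** * Complex structures with prescribed spectrum *)

Section LevelSet.
Variables (R : realType) (m : nat) (G J K1 p : 'M[R]_m.+1).
Hypothesis hG : is_metric G.
Hypothesis (JJ : J * J = -1) (aJ : adjoint G J = - J).
Hypothesis (KK1 : K1 * K1 = -1) (aK1 : adjoint G K1 = - K1).
Hypothesis (ap : adjoint G p = p) (Jp : GRing.comm J p) (K1p : GRing.comm K1 p).
Local Notation adj := (adjoint G).
Local Notation bracket A B := (A * B - B * A).
Implicit Types (A B K L Z : 'M[R]_m.+1).

(** The leaf through [K1] is contained in this set and agrees with it near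
    [K1]. Unlike membership in the leaf, these conditions are equations, which
    can be verified along a curve. *)
Definition level_set : set 'M[R]_m.+1 :=
  [set L | [/\ L * L = -1, adj L = - L, isospectral J K1 L & L * p = K1 * p]].

Lemma isospectral_refl : isospectral J K1 K1.
Proof. exact: mx_root_minpoly. Qed.

Lemma unitary_conj_level B :
  unitary_fixing G J p B -> level_set (B * K1 * adj B).
Proof.
move=> [BB BJ Bp]; have BB' := adjoint_inv BB.
have ap' : adj B * p = p by rewrite -{1}Bp mulrA BB mul1r.
split.
- rewrite !mulrA -(mulrA (B * K1)) BB mulr1 -(mulrA B) KK1.
  by rewrite mulrN1 mulNr BB'.
- by rewrite !adjM// adjK// aK1 !mulNr mulrN mulrA.
- have BA : B * (J * K1) = J * (B * K1 * adj B) * B.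
    by rewrite -!mulrA BB mulr1 !mulrA BJ.
  have := horner_mx_intertwined (mxminpoly (J * K1)) BA.
  rewrite mx_root_minpoly mulr0 => /esym h0.
  rewrite /isospectral; move: h0; move: (horner_mx _ _) => H HB.
  by rewrite -[H]mulr1 -BB' mulrA HB mul0r.
- by rewrite -!mulrA ap' K1p mulrA Bp.
Qed.

Variable e : {poly R}.
Hypothesis eP :
  exists w, e * (mxminpoly (J * K1))^`() + w * mxminpoly (J * K1) = 1.
Variable Q : 'M[R]_m.+1.
Hypothesis QGQ : Q^T *m G *m Q = 1%:M.
Local Notation twine := (intertwiner J K1 e).

(** For [Z = B - B^*] with [B] intertwining [K] and [L], criticality reads
    [tr (D B D) = 0] where [D = L - K] is skew; the form is definite for [B]
    close to the identity. *)
Lemma level_set_critical K L : level_set K -> level_set L ->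
  near_one Q (twine K L) ->
  (forall Z, u_alg_fixing G J p Z -> \tr ((bracket (Z) K) * L) = 0) -> L = K.
Proof.
move=> [KK aK isoK KpE] [LL aL isoL LpE] Bnear crit.
set B := twine K L in Bnear *.
have BK : L * B = B * K by exact: intertwinerP.
have BJ : J * B = B * J by exact: intertwinerJ.
have pK : p * K = p * K1.
  by have := congr1 adj KpE; rewrite !adjM// ap aK aK1 !mulrN => /oppr_inj.
have pL : p * L = p * K1.
  by have := congr1 adj LpE; rewrite !adjM// ap aL aK1 !mulrN => /oppr_inj.
have Kp : GRing.comm K p by rewrite /GRing.comm KpE pK K1p.
have Bp : B * p = p by apply: intertwiner_eq_on => //; rewrite LpE KpE.
have pB : p * B = p by apply: intertwiner_eq_on_l => //; rewrite pL pK.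
have aBp : adj B * p = p by have := congr1 adj pB; rewrite adjM// ap.
have aBL : adj B * L = K * adj B.
  have := congr1 adj BK; rewrite !adjM// aK aL mulNr mulrN => /oppr_inj.
  by [].
have aBJ : GRing.comm (adj B) J.
  by have := congr1 adj BJ; rewrite !adjM// aJ mulNr mulrN => /oppr_inj.
have hZ : u_alg_fixing G J p (B - adj B).
  split; first by rewrite adjB adjK// opprB.
    by apply/commr_sym/commrB; [exact: BJ|exact/commr_sym].
  by rewrite mulrBl Bp aBp subrr.
pose D := L - K.
have aD : adj D = - D by rewrite adjB aK aL opprB opprK addrC.
have ZK : (bracket (B - adj B) K) = D * B + adj B * D.
  rewrite /D [in LHS]mulrBl [in LHS]mulrBr -BK -aBL.
  by rewrite opprB (addrC (adj B * L)) addrACA (addrC (- _)) mulrBl mulrBr.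
have trC A A' : \tr (A * A') = \tr (A' * A) by exact: mxtrace_mulC.
have ZKK : \tr ((bracket (B - adj B) K) * K) = 0.
  set Z := B - adj B; rewrite mulrBl linearB /= -(mulrA Z) -(mulrA K) (trC K).
  by rewrite -mulrA subrr.
have := crit _ hZ; rewrite -[L](subrK K) -/D mulrDr linearD /= ZKK addr0.
rewrite ZK mulrDl linearD /= -(mulrA (adj B)) (trC (adj B)).
have -> : \tr (D * D * adj B) = \tr (D * B * D).
  rewrite -(mxtrace_adj hG (D * B * D)) !adjM// aD mulNr mulrN mulrN opprK.
  by rewrite [LHS]trC [RHS]trC !mulrA.
move=> /eqP; rewrite -mulr2n mulrn_eq0 /= => /eqP trD.
apply/subr0_eq; rewrite addrK; apply/eqP/negPn/negP => D0.
have := mxtrace_near_one_gt0 hG QGQ Bnear D0.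
by rewrite aD !mulNr linearN /= trD oppr0 ltxx.
Qed.

Lemma cvg_horner_mx (T : Type) (F : set_system T) (FF : Filter F)
    (f : T -> 'M[R]_m.+1) (A : 'M[R]_m.+1) q :
  f t @[t --> F] --> A -> horner_mx (f t) q @[t --> F] --> horner_mx A q.
Proof.
move=> fA; elim/poly_ind: q => [|q c IHq].
  by rewrite rmorph0; under eq_cvg do rewrite rmorph0; exact: cvg_cst.
rewrite rmorphD rmorphM /= horner_mx_X horner_mx_C.
under eq_cvg do rewrite rmorphD rmorphM /= horner_mx_X horner_mx_C.
by apply: cvgD; [exact: cvg_mulr|exact: cvg_cst].
Qed.

Lemma cvg_divided_difference (T : Type) (F : set_system T) (FF : Filter F)
    (f g : T -> 'M[R]_m.+1) (A B : 'M[R]_m.+1) s :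
  f t @[t --> F] --> A -> g t @[t --> F] --> B ->
  divided_difference s (f t) (g t) @[t --> F] --> divided_difference s A B.
Proof.
move=> fA gB; elim: s => [|c s IHs] /=; first exact: cvg_cst.
by apply: cvgD; [exact: cvg_horner_mx|exact: cvg_mulr].
Qed.

Lemma cvg_intertwiner (T : Type) (F : set_system T) (FF : Filter F)
    (f g : T -> 'M[R]_m.+1) (A B : 'M[R]_m.+1) :
  f t @[t --> F] --> A -> g t @[t --> F] --> B ->
  twine (f t) (g t) @[t --> F] --> twine A B.
Proof.
move=> fA gB; rewrite /intertwiner.
have cJ : J @[t --> F] --> J by exact: cvg_cst.
have cB : divided_difference (mxminpoly (J * K1)) (J * g t) (J * f t) *
    horner_mx (J * f t) e @[t --> F] -->
    divided_difference (mxminpoly (J * K1)) (J * B) (J * A) * horner_mx (J * A) e.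
  apply: cvg_mulr.
    by apply: cvg_divided_difference; exact: cvg_mulr.
  by apply: cvg_horner_mx; exact: cvg_mulr.
have cJB := @cvg_mulr _ _ _ FF _ _ _ _ _ cJ cB.
have cJBJ := @cvg_mulr _ _ _ FF _ _ _ _ _ cJB cJ.
apply: cvgZ; first exact: cvg_cst.
exact: (cvgB cB (cvg_mulr (cvg_mulr cJ cB) cJ)).
Qed.

(** The intertwiner depends continuously on its two arguments and is the
    identity at [(K1, K1)]. *)
Lemma near_one_intertwiner : exists2 r : R, 0 < r &
  forall K L, ball K1 r K -> ball K1 r L -> near_one Q (twine K L).
Proof.
have B1 : twine K1 K1 = 1 by apply: intertwiner_diag => //; exact: isospectral_refl.
have cB : twine KL.1 KL.2 @[KL --> nbhs (K1, K1)] --> (1 : 'M[R]_m.+1).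
  rewrite -B1; apply: (@cvg_intertwiner _ _ (nbhs_filter _)).
    exact: cvg_fst.
  exact: cvg_snd.
have Qu := frame_unit QGQ.
have cE : Q^-1 * twine KL.1 KL.2 * Q - 1 @[KL --> nbhs (K1, K1)]
    --> (0 : 'M[R]_m.+1).
  have -> : (0 : 'M[R]_m.+1) = Q^-1 * 1 * Q - 1.
    by rewrite mulr1 mulVr// subrr.
  apply: cvgB; last exact: cvg_cst.
  apply: cvg_mulr; last exact: cvg_cst.
  by apply: cvg_mulr => //; exact: cvg_cst.
have c0 : 0 < (2 * m.+1%:R)^-1 :> R by rewrite invr_gt0 mulr_gt0.
have near0 : nbhs (K1, K1) [set KL | near_one Q (twine KL.1 KL.2)].
  have := (@cvgr_norm_le _ _ _ _ (nbhs_filter _) _ _ cE _ _).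
  rewrite normr0 => /(_ _ c0); apply: filterS => KL /= normE i j.
  apply: le_trans normE; rewrite [leRHS]/Num.Def.normr /= mx_normrE.
  exact: (le_bigmax _ _ (i, j)).
have [r /= r0 rP] := (nbhs_ballP _ _).1 near0.
by exists r => // K L Kr Lr; exact: (rP (K, L) (conj Kr Lr)).
Qed.

End LevelSet.

(** * Openness of the charts *)

Lemma is_derive_along_line (R : realType) (V W : normedModType R) (f : V -> W)
    (x v : V) (t : R) df :
  is_derive (t *: v + x) v f df -> is_derive t 1 (fun s : R => f (s *: v + x)) df.
Proof.
move=> /is_deriveE fd; apply/is_deriveE.
suff -> : (fun h : R => h^-1 *: (f ((h *: 1 + t) *: v + x) - f (t *: v + x))) =
  (fun h : R => h^-1 *: (f (h *: v + (t *: v + x)) - f (t *: v + x))) by [].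
apply/funext => h; rewrite scalerDl [h *: 1]mulr1 addrA.
by [].
Qed.

Section LocalSurjectivity.
Variables (R : realType) (m : nat) (G J K1 p : 'M[R]_m.+1).
Hypothesis hG : is_metric G.
Hypothesis (JJ : J * J = -1) (aJ : adjoint G J = - J).
Hypothesis (KK1 : K1 * K1 = -1) (aK1 : adjoint G K1 = - K1).
Hypothesis (ap : adjoint G p = p) (Jp : GRing.comm J p) (K1p : GRing.comm K1 p).
Variables (d : nat) (C : 'I_d -> 'M[R]_m.+1).
Hypothesis CP : forall i, u_alg_fixing G J p (C i).
Hypothesis Csurj : forall Z, u_alg_fixing G J p Z ->
  exists x, Z * K1 - K1 * Z = combo C x * K1 - K1 * combo C x.
Local Notation adj := (adjoint G).
Local Notation slope := (chart_slope K1 C).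
Local Notation chart := (chart K1 C).
Local Notation level := (level_set G J K1 p).

Lemma chart_level x : level (chart x).
Proof.
have [uP uE] := chart_unitary hG CP x.
by have := unitary_conj_level hG KK1 aK1 K1p uP; rewrite uE.
Qed.

(** Both sides have dimension [d], being conjugate by the Cayley transform to
    the distribution at [K1]. *)
Lemma slope_diag_surj x : (forall z, slope x x z = 0 -> z = 0) ->
  forall Z, u_alg_fixing G J p Z ->
  exists v, slope x x v = Z * chart x - chart x * Z.
Proof.
move=> inj Z hZ.
have [uP uE] := chart_unitary hG CP x.
have w1 := cayley_mulN hG (adj_combo CP x).
have slopeE v := chart_slope_diag K1 hG CP x v.
have wP := unitary_fixingV hG aJ uP; rewrite uE in wP.
have cE : chart x = cayley (combo C x) * K1 * cayley (- combo C x) by [].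
rewrite {}cE; case: uP wP => uu uJ up [ww wJ wp]; rewrite uE in uu.
move: (cayley (combo C x)) (cayley (- combo C x)) uE w1 slopeE uu uJ up ww wJ wp.
move=> u w uE uw slopeE wu uJ up ww wJ wp.
pose om (Y : 'M[R]_m.+1) := (1 + combo C x)^-1 * Y * (1 - combo C x)^-1.
have /choice[t tP] : forall i, exists t,
    om (C i) * K1 - K1 * om (C i) = combo C t * K1 - K1 * combo C t.
  by move=> i; apply: Csurj; apply: u_alg_fixing_cayley => //; exact: combo_alg.
pose T : 'M[R]_d := \matrix_i t i.
have TE v : combo C (v *m T) * K1 - K1 * combo C (v *m T) =
    om (combo C v) * K1 - K1 * om (combo C v).
  rewrite bracket_combo mulmx_sum_row.
  have -> : om (combo C v) = combo (fun i => om (C i)) v.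
    rewrite /om /combo mulr_sumr mulr_suml; apply: eq_bigr => i _.
    by rewrite -scalerAr -scalerAl.
  rewrite (bracket_combo K1 (fun i => om (C i))).
  under [RHS]eq_bigr do rewrite tP bracket_combo scaler_sumr.
  rewrite exchange_big /=; apply: eq_bigr => j _.
  rewrite summxE scaler_suml; apply: eq_bigr => i _.
  by rewrite scalerA mxE rowK.
(* [T] expresses the twisted frame [om (C i)] in the frame [C]. *)
have Tu : T \in unitmx.
  rewrite -row_free_unit; apply: inj_row_free => v vT; apply: inj.
  rewrite slopeE -/(om _) -TE vT combo0 mul0r mulr0 subrr scaler0 mulr0.
  by rewrite mul0r.
have hZ' : u_alg_fixing G J p (w * Z * u).
  case: hZ => aZ ZJ Zp; split.
  - by rewrite !adjM// uE aZ -uE adjK// mulNr mulrN mulrA.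
  - by apply/commr_sym; do ?[apply: commrM]; apply/commr_sym.
  - by rewrite -!mulrA up Zp mulr0.
have [s sP] := Csurj hZ'.
exists ((2^-1 *: s) *m invmx T).
have halfE : combo C (2^-1 *: s) * K1 - K1 * combo C (2^-1 *: s) =
    2^-1 *: (combo C s * K1 - K1 * combo C s).
  by rewrite comboZ -scalerAl -scalerAr scalerBr.
rewrite slopeE -/(om _) -TE mulmxKV// halfE.
rewrite scalerA divff ?pnatr_eq0// scale1r -sP mulrBr mulrBl !mulrA uw mul1r.
by rewrite -[_ * Z * u * w]mulrA uw mulr1.
Qed.

Variable e : {poly R}.
Hypothesis eP :
  exists w, e * (mxminpoly (J * K1))^`() + w * mxminpoly (J * K1) = 1.
Variable Q : 'M[R]_m.+1.
Hypothesis QGQ : Q^T *m G *m Q = 1%:M.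
Variables (r s : R).
Hypothesis slope_inj : forall x y, ball 0 r x -> ball 0 r y ->
  forall z, slope x y z = 0 -> z = 0.
Hypothesis chart_near : forall x, ball 0 r x -> ball K1 s (chart x).
Hypothesis near_twine : forall K L, ball K1 s K -> ball K1 s L ->
  near_one Q (intertwiner J K1 e K L).

Lemma chart_inj x y : ball 0 r x -> ball 0 r y -> chart x = chart y -> x = y.
Proof.
move=> xr yr xy; apply/subr0_eq/(slope_inj xr yr).
by rewrite -(chart_sub K1 hG CP) xy subrr.
Qed.

(** The differential of the chart covers every direction [[Z, chart x]] of the
    distribution, so a critical point of the restricted function is critical in
    the sense of [level_set_critical]. *)
Lemma chart_critical x L : ball 0 r x -> level L -> ball K1 s L ->
  (forall v, \tr (slope x x v * L) = 0) -> chart x = L.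
Proof.
move=> xr levL Ls crit; apply/esym.
apply: (level_set_critical hG JJ aJ aK1 ap Jp K1p eP QGQ) => //.
- exact: chart_level.
- exact: near_twine (chart_near xr) Ls.
move=> Z hZ; have [v <-] := slope_diag_surj (slope_inj xr xr) hZ.
exact: crit.
Qed.

(** All points of the level set have the same length, as [L^* L = - L L = 1]. *)
Lemma mxtrace_level_sub K L : level K -> level L ->
  \tr ((K - L) * L) = 2^-1 * \tr (adj (K - L) * (K - L)).
Proof.
move=> [KK aK _ _] [LL aL _ _].
have -> : adj (K - L) = L - K by rewrite adjB aK aL opprK addrC.
have trC (A B : 'M[R]_m.+1) : \tr (A * B) = \tr (B * A) by exact: mxtrace_mulC.
have -> : (L - K) * (K - L) = L * K - L * L - (K * K - K * L).
  by rewrite mulrBl !mulrBr.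
by rewrite mulrBl KK LL !linearB /= (trC L K); field.
Qed.

(** For [L] close to [chart x0] the function [x |-> tr (chart x L)] is smaller
    at [x0] than on a sphere around [x0]. Its minimum on the ball is therefore
    interior, and the critical value can only be [L]. *)
Lemma chart_locally_surjective (O : set 'rV[R]_d) x0 :
  open O -> O `<=` ball 0 r -> O x0 ->
  nbhs (chart x0) [set L | level L -> exists2 x, O x & chart x = L].
Proof.
move=> Oopen Or Ox0.
have cc : continuous chart := @continuous_chart _ _ _ _ K1 _ hG _ _ CP.
have [rh rh0 rhO] : exists2 rh : R, 0 < rh & forall x, `|x0 - x| <= rh -> O x.
  have /nbhs_ballP[s0 /= s00 sO] : nbhs x0 O by apply: open_nbhs_nbhs.
  exists (s0 / 2); first by rewrite divr_gt0.
  move=> x xs; apply: sO; rewrite -ball_normE /ball_ /=.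
  by rewrite (le_lt_trans xs)// ltr_pdivrMr// mulr_natr mulr2n ltrDl.
pose B := closed_ball_ (fun x => `|x|) x0 rh; pose Sp := B `\` ball x0 rh.
have Bclosed : closed B by exact: closed_closed_ball_.
have Bcompact : compact B.
  apply: bounded_closed_compact => //; exists (`|x0| + rh).
  split=> [|M ltM x Bx]; first exact: num_real.
  rewrite /= (le_trans _ (ltW ltM))// -[x](subKr x0) (le_trans (ler_normB _ _))//.
  by rewrite lerD2l.
have Spcompact : compact Sp.
  apply: (@subclosed_compact _ _ B) => //; last by move=> x [].
  by apply: closedI => //; apply: open_closedC; exact: ball_open.
have x0r := Or _ Ox0; have lev0 := chart_level x0.
(* By compactness of the sphere, positivity persists for all [L] near
   [chart x0] at once. *)
have tube : \forall L \near chart x0,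
    Sp `<=` (fun x => 0 < \tr ((chart x - chart x0) * L)).
  apply: ((compact_near_coveringP Sp).1 Spcompact _ (nbhs (chart x0))
    (fun L x => 0 < \tr ((chart x - chart x0) * L))) => x [Bx xN].
  have xr : ball 0 r x by apply/Or/rhO.
  have pos : 0 < \tr ((chart x - chart x0) * chart x0).
    rewrite (mxtrace_level_sub (chart_level x) lev0) mulr_gt0 ?invr_gt0//.
    have [Q' QGQ'] := metric_frame hG.
    have := mxtrace_near_one_gt0 hG QGQ' (near_one_refl QGQ').
    rewrite -[X in \tr X]mulr1; move=> /(_ (chart x - chart x0)).
    rewrite !mulr1; apply; rewrite subr_eq0; apply/eqP => /chart_inj xx0.
    by apply: xN; rewrite xx0//; exact: ballxx.
  have cv : \tr ((chart xL.1 - chart x0) * xL.2)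
      @[xL --> filter_prod (nbhs x) (nbhs (chart x0))]
      --> \tr ((chart x - chart x0) * chart x0).
    apply: cvg_mxtrace; apply: cvg_mulr; last exact: cvg_snd.
    apply: cvgB; last exact: cvg_cst.
    apply: (cvg_comp _ _ cvg_fst).
    exact: cc.
  exact: (cvgr_gt _ cv _ pos).
have nears : \forall L \near chart x0, ball K1 s L.
  by apply: open_nbhs_nbhs; split; [exact: ball_open|exact: chart_near].
apply: filterS2 tube nears => L tubeL Ls levL.
have cf : continuous (fun x => \tr (chart x * L)).
  move=> x.
  have cL : (fun=> L) @ nbhs x --> L by apply: cst_continuous.
  have cx := @cvg_mulr _ _ _ (nbhs_filter x) _ _ _ _ _ (cc x) cL.
  have := (@cvg_mxtrace _ _ _ (nbhs_filter x) _ _ _ cx). exact.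
have [c cB cmin] : exists2 c, c \in B &
    forall t, t \in B -> \tr (chart c * L) <= \tr (chart t * L).
  apply: (@EVT_min_rV _ _ (fun x => \tr (chart x * L))) => //.
    by exists x0; rewrite /B /closed_ball_ /= subrr normr0 ltW.
  exact: continuous_subspaceT.
rewrite inE in cB.
(* On the sphere the value exceeds the one at the centre. *)
have cint : `|x0 - c| < rh.
  rewrite ltNge; apply/negP => rhc.
  have : 0 < \tr ((chart c - chart x0) * L).
    apply: tubeL; split=> //; rewrite -ball_normE /ball_ /=.
    by apply/negP; rewrite -leNgt.
  rewrite mulrBl linearB /= subr_gt0 ltNge cmin// inE /B /closed_ball_ /=.
  by rewrite subrr normr0 ltW.
exists c; first exact: rhO.
apply: chart_critical => // [|v]; first exact/Or/rhO.
have [eps eps0 epsP] : exists2 eps : R, 0 < eps &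
    forall t : R, `|t| < eps -> `|x0 - (t *: v + c)| < rh.
  have cl : `|x0 - (t *: v + c)| @[t --> (0 : R)] --> `|x0 - (0 *: v + c)|.
    apply: cvg_norm; apply: cvgB; first exact: cvg_cst.
    apply: cvgD; last exact: cvg_cst.
    by apply: cvgZ; [exact: cvg_id|exact: cvg_cst].
  rewrite scale0r add0r in cl.
  have [eps /= eps0 epsP] := (nbhs_ballP _ _).1 (cvgr_lt _ cl _ cint).
  exists eps => // t teps; apply: epsP.
  by rewrite -ball_normE /ball_ /= sub0r normrN.
pose phi (t : R) := \tr (chart (t *: v + c) * L).
have phid (t : R) : is_derive t 1 phi (\tr (slope (t *: v + c) (t *: v + c) v * L)).
  have d1 := is_derive_along_line (is_derive_chart K1 hG CP (t *: v + c) v).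
  have d2 : is_derive t 1 (fun s : R => chart (s *: v + c) * L)
      (slope (t *: v + c) (t *: v + c) v * L).
    have d3 := is_derive_mulr d1 (is_derive_cst L t 1).
    by apply: is_derive_eq d3 _; rewrite mulr0 addr0.
  exact: is_derive_mxtrace d2.
have : is_derive (0 : R) 1 phi 0.
  apply: (@derive1_at_min _ _ (- eps) eps).
  - by rewrite (le_trans _ (ltW eps0))// oppr_le0 ltW.
  - by move=> t _; have [] := phid t.
  - by rewrite in_itv /= oppr_lt0 eps0.
  - move=> t; rewrite in_itv /= -ltr_norml => teps.
    rewrite /phi scale0r add0r; apply: cmin; rewrite inE /B /closed_ball_ /=.
    exact/ltW/epsP.
move=> [_ phi0]; have [_] := phid 0; rewrite phi0 scale0r add0r.
by move=> ->.
Qed.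

End LocalSurjectivity.

(** * Local parametrizations of the orbit *)

Section LocalChart.
Variables (R : realType) (m : nat) (G J K1 p : 'M[R]_m.+1).
Hypothesis hG : is_metric G.
Hypothesis (JJ : J * J = -1) (aJ : adjoint G J = - J).
Hypothesis (KK1 : K1 * K1 = -1) (aK1 : adjoint G K1 = - K1).
Hypothesis (ap : adjoint G p = p) (Jp : GRing.comm J p) (K1p : GRing.comm K1 p).
Local Notation adj := (adjoint G).

(** [J K1] is orthogonal, hence normal. *)
Lemma isospectral_bezout : exists (e w : {poly R}),
  e * (mxminpoly (J * K1))^`() + w * mxminpoly (J * K1) = 1.
Proof.
have /(normal_separable_mxminpoly hG) : adj (J * K1) * (J * K1) = J * K1 * adj (J * K1).
  rewrite adjM// aJ aK1 mulrNN -!mulrA (mulrA J J) (mulrA K1 K1) JJ KK1.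
  by rewrite !mulN1r !mulrN KK1 JJ.
rewrite unlock => /Bezout_eq1_coprimepP[[w e] /= weE].
by exists e, w; rewrite addrC.
Qed.

(** Homogeneity: the distribution has the same dimension at all points of an
    orbit. *)
Lemma bracket_frame_conj K d (C : 'I_d -> 'M[R]_m.+1) B :
  unitary_fixing G J p B -> bracket_frame G J p K C ->
  bracket_frame G J p (B * K * adj B) (fun i => B * C i * adj B).
Proof.
move=> BP [CP Cinj Csurj]; have BP' := unitary_fixingV hG aJ BP.
have [BB _ _] := BP; have BB' := adjoint_inv BB.
have algB A Z : unitary_fixing G J p A -> u_alg_fixing G J p Z ->
    u_alg_fixing G J p (A * Z * adj A).
  move=> AP [aZ ZJ Zp]; have [AA AJ _] := AP.
  have [_ AJ' Ap'] := unitary_fixingV hG aJ AP; split.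
  - by rewrite !adjM// adjK// aZ mulNr mulrN mulrA.
  - by apply/commr_sym; do ?[apply: commrM]; apply/commr_sym.
  - by rewrite -!mulrA Ap' Zp mulr0.
have conjM A D : B * A * adj B * (B * D * adj B) = B * (A * D) * adj B.
  by rewrite !mulrA -(mulrA (B * A)) BB mulr1.
have comboE x : combo (fun i => B * C i * adj B) x = B * combo C x * adj B.
  rewrite /combo mulr_sumr mulr_suml; apply: eq_bigr => i _.
  by rewrite -scalerAr -scalerAl.
have brE Z : B * Z * adj B * (B * K * adj B) - B * K * adj B * (B * Z * adj B)
    = B * (Z * K - K * Z) * adj B by rewrite !conjM mulrBr mulrBl.
split=> [i|x|Z hZ]; first exact: algB.
  rewrite comboE brE => e; apply: Cinj.
  have := congr1 (fun Y => adj B * Y * B) e; rewrite mulr0 mul0r !mulrA BB mul1r.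
  by rewrite -mulrA BB mulr1.
have hZ' : u_alg_fixing G J p (adj B * Z * B).
  by have := algB _ _ BP' hZ; rewrite adjK.
have [x xE] := Csurj _ hZ'; exists x; rewrite comboE brE -xE -brE.
have -> : B * (adj B * Z * B) * adj B = Z; last by [].
by rewrite !mulrA BB' mul1r -mulrA BB' mulr1.
Qed.

(** The radius is small enough for the slope of the Cayley chart to be injective
    and for the intertwiners of its values to be close to the identity. The last
    clause makes the chart open as a map into the orbit, and even into the level
    set. *)
Lemma local_chart d (C : 'I_d -> 'M[R]_m.+1) : bracket_frame G J p K1 C ->
  exists (c : 'rV[R]_d -> 'M[R]_m.+1) (r : R),
  [/\ 0 < r /\ c 0 = K1,
      forall x, exists2 B, unitary_fixing G J p B & c x = B * K1 * adj B,
      continuous c /\ smooth_on (ball 0 r) c,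
      (forall x y, ball 0 r x -> ball 0 r y -> c x = c y -> x = y) /\
      (forall x, ball 0 r x ->
        (forall v, 'D_v c x = 0 -> v = 0) /\
        [set 'D_v c x | v in [set: 'rV[R]_d]] =
          [set Z * c x - c x * Z | Z in u_alg_fixing G J p]) &
      forall (O : set 'rV[R]_d) x, open O -> O `<=` ball 0 r -> O x ->
        nbhs (c x) [set L | level_set G J K1 p L -> exists2 y, O y & c y = L]].
Proof.
move=> [CP Cinj Csurj]; have [e eP] := isospectral_bezout.
have [Q QGQ] := metric_frame hG.
have [r1 r10 slope_inj] := slope_injective_near hG CP Cinj.
have [s s0 near_twine] := near_one_intertwiner JJ eP QGQ.
pose c := chart K1 C.
have cc : continuous c := @continuous_chart _ _ _ _ K1 _ hG _ _ CP.
have c0 : c 0 = K1.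
  by rewrite /c /chart combo0 oppr0 cayley0 mul1r mulr1.
have [r2 /= r20 chart_near] : exists2 r2 : R, 0 < r2 &
    forall x, ball 0 r2 x -> ball K1 s (c x).
  have nb : nbhs (c 0) (ball K1 s) by rewrite c0; exact: nbhsx_ballx.
  have [r2 /= r20 r2P] := (nbhs_ballP _ _).1 (cc 0 _ nb).
  by exists r2.
pose r := Num.min r1 r2.
have rr1 x : ball 0 r x -> ball (0 : 'rV[R]_d) r1 x.
  by apply: le_ball; rewrite ge_min lexx.
have rr2 x : ball 0 r x -> ball (0 : 'rV[R]_d) r2 x.
  by apply: le_ball; rewrite ge_min lexx orbT.
have sinj x y : ball 0 r x -> ball 0 r y -> forall z, chart_slope K1 C x y z = 0 -> z = 0.
  by move=> /rr1 xr /rr1 yr; exact: slope_inj.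
have Dc x v : 'D_v c x = chart_slope K1 C x x v.
  by have [] := is_derive_chart K1 hG CP x v.
exists c, r; split.
- by rewrite lt_min r10 r20.
- move=> x; have [uP uE] := chart_unitary hG CP x.
  by exists (cayley (combo C x)) => //; rewrite uE.
- by split=> //; exact: (smooth_chart K1 hG CP).
- split; first by move=> x y; exact: (chart_inj hG CP sinj).
  move=> x xr; split; first by move=> v; rewrite Dc; exact: sinj.
  apply/seteqP; split=> X /=.
    move=> [v _ <-]; rewrite Dc (chart_slope_diag K1 hG CP) /=.
    have [uP uE] := chart_unitary hG CP x.
    have w1 := cayley_mulN hG (adj_combo CP x).
    have zP := u_alg_fixing_cayley hG ap (combo_alg CP x) (combo_alg CP v).
    move: zP => /=; set Z := _ * _ * _; clearbody Z => zP.
    exists (2 *: (cayley (combo C x) * Z * cayley (- combo C x))).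
      apply: u_alg_fixingZ; have wP := unitary_fixingV hG aJ uP.
      rewrite uE in wP; case: uP wP zP => _ uJ up [_ wJ wp] [aZ ZJ Zp]; split.
      - by rewrite -uE !adjM// adjK// aZ mulNr mulrN mulrA.
      - by apply/commr_sym; do ?[apply: commrM]; apply/commr_sym.
      - by rewrite -!mulrA wp Zp mulr0.
    have w2 : cayley (- combo C x) * cayley (combo C x) = 1 by exact: mulmx1C w1.
    rewrite /c /chart -scalerAl -scalerAr -scalerBr -scalerAr -scalerAl.
    congr (_ *: _); move: (cayley _) (cayley _) w2 => u w wu.
    rewrite mulrBr mulrBl !mulrA -(mulrA (u * Z)) wu mulr1.
    by rewrite -(mulrA (u * K1)) wu mulr1.
  move=> [Z hZ <-]; have [v vE] := slope_diag_surj hG aJ ap CP Csurj (sinj x x xr xr) hZ.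
  by exists v; rewrite // Dc.
- move=> O x Oopen Or Ox.
  apply: (chart_locally_surjective hG JJ aJ KK1 aK1 ap Jp K1p CP Csurj eP QGQ
    sinj _ near_twine) => //.
  by move=> y /rr2; exact: chart_near.
Qed.

End LocalChart.

(** * Factorization of unitary transformations *)

Section OrbitConnected.
Variables (R : realType) (m : nat) (G J p : 'M[R]_m.+1).
Hypothesis hG : is_metric G.
Hypothesis (JJ : J * J = -1) (aJ : adjoint G J = - J).
Hypothesis (ap : adjoint G p = p) (pp : p * p = p) (Jp : GRing.comm J p).
Local Notation adj := (adjoint G).
Implicit Types (A B V X : 'M[R]_m.+1).

(** Solving [A = (1 + X) (1 - X)^-1] for [X]. *)
Lemma cayley_surj A : unitary_fixing G J p A -> A + 1 \is a GRing.unit ->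
  exists2 X, u_alg_fixing G J p X & cayley X = A.
Proof.
move=> [AA AJ Ap] Au; have AA' := adjoint_inv AA.
pose X := (A + 1)^-1 * (A - 1).
have AX : (A + 1) * X = A - 1 by rewrite mulrA mulrV// mul1r.
have XA : X * (A + 1) = A - 1.
  rewrite /X -mulrA (_ : (A - 1) * (A + 1) = (A + 1) * (A - 1)).
    by rewrite mulrA mulVr// mul1r.
  by rewrite mulrBl mulrDl !mulrDr !mulrN !mulr1 !mul1r opprD addrACA.
exists X.
  split.
  - apply/eqP; rewrite -addr_eq0; apply/eqP; apply: (mulrI Au).
    rewrite mulr0 mulrDr AX.
    have : adj (A + 1) * adj X = adj (A - 1) by rewrite -adjM// XA.
    rewrite adjD adjB adjoint1// => /(congr1 (fun Y => A * Y)).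
    rewrite mulrA mulrDr mulrBr AA' mulr1 addrC => ->.
    by rewrite addrA subrK subrr.
  - apply/commr_sym; apply: commrM.
      by apply/commrV/commrD; [exact/commr_sym|exact: commr1].
    by apply: commrB; [exact/commr_sym|exact: commr1].
  - by rewrite /X -mulrA mulrBl mul1r Ap subrr mulr0.
have e : 1 - X = 2 *: (A + 1)^-1.
  apply: (mulrI Au); rewrite mulrBr mulr1 AX -scalerAr mulrV//.
  by rewrite opprB addrC addrA subrK scaler_nat.
rewrite /cayley e.
have u2 : (2 : R) \is a GRing.unit by rewrite unitfE pnatr_eq0.
have -> : (2 *: (A + 1)^-1)^-1 = 2^-1 *: (A + 1).
  by rewrite invrZ// ?unitrV// invrK.
by rewrite scalerA divff ?pnatr_eq0// scale1r addrK.
Qed.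

Lemma J_alg : u_alg_fixing G J p (J * (1 - p)).
Proof.
have J1p : GRing.comm J (1 - p) by apply: commrB => //; exact: commr1.
split.
- by rewrite adjM// adjB adjoint1// ap aJ mulrN -J1p.
- by rewrite /GRing.comm -mulrA -J1p.
- by rewrite -mulrA mulrBl mul1r pp subrr mulr0.
Qed.

(** On the kernel of [p] the Cayley transform of [t J] is multiplication by a
    complex number of modulus one. *)
Lemma cayley_J (t : R) V : p * V = 0 ->
  cayley (t *: (J * (1 - p))) * V =
  ((1 - t ^+ 2) / (1 + t ^+ 2)) *: V + (2 * t / (1 + t ^+ 2)) *: (J * V).
Proof.
move=> pV; have t2 : 1 + t ^+ 2 != 0.
  by rewrite gt_eqF// ltr_wpDr ?sqr_ge0.
have [aX _ _] := u_alg_fixingZ t J_alg; set X := t *: _ in aX *.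
have Xu := skew_unit hG aX.
have XV W : p * W = 0 -> X * W = t *: (J * W).
  move=> pW; rewrite /X -scalerAl -mulrA mulrBl mul1r pW subr0.
  by [].
have pJV : p * (J * V) = 0 by rewrite mulrA -Jp -mulrA pV mulr0.
rewrite /cayley mulrBl mul1r -scalerAl.
suff -> : (1 - X)^-1 * V = (1 + t ^+ 2)^-1 *: (V + t *: (J * V)).
  rewrite !scalerDr !scalerA addrAC -[X in _ - X]scale1r -scalerBl.
  by congr (_ *: _ + _ *: _); field.
apply: (mulrI Xu); rewrite mulrA mulrV// mul1r -scalerAr mulrBl mul1r.
rewrite mulrDr -scalerAr !XV// scalerA [J * (J * V)]mulrA JJ mulN1r scalerN.
rewrite opprD addrA addrK opprK -expr2.
have -> : V + t ^+ 2 *: V = (1 + t ^+ 2) *: V by rewrite scalerDl scale1r.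
by rewrite scalerA mulVf// scale1r.
Qed.

(** The operator [B + B^*] has finitely many eigenvalues, which leaves a scalar
    [z] of modulus one such that [-1] is no eigenvalue of [z^-1 B]. *)
Lemma unitary_cayley_decomposition B : unitary_fixing G J p B ->
  exists t X, u_alg_fixing G J p X /\
    B = cayley (t *: (J * (1 - p))) * cayley X.
Proof.
move=> BP; have [BB BJ Bp] := BP; have BB' := adjoint_inv BB.
pose al (t : R) := -2 * ((1 - t ^+ 2) / (1 + t ^+ 2)).
pose S := B + adj B.
have pos (t : R) : 1 + t ^+ 2 != 0 by rewrite gt_eqF// ltr_wpDr ?sqr_ge0.
have al_inj : injective (fun s : nat => al s%:R).
  move=> s t; rewrite /al => /(mulfI _) e.
  have {}e : s%:R ^+ 2 = t%:R ^+ 2 :> R.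
    have := e _; rewrite oppr_eq0 pnatr_eq0 => /(_ isT) /eqP.
    rewrite eqr_div// => /eqP e2.
    have : 2 * (s%:R ^+ 2 - t%:R ^+ 2) = 0 :> R by move: e2; lra.
    by move/eqP; rewrite mulf_eq0 pnatr_eq0 /= subr_eq0 => /eqP.
  move: e => /eqP; rewrite eqrXn2// ?ler0n// eqr_nat.
  by move/eqP.
have [t tP] : exists t : R, ~~ root (char_poly S) (al t).
  (* More candidates than the degree [m + 1] of the characteristic polynomial. *)
  pose rs := [seq al s%:R | s <- iota 0 m.+3].
  have : ~~ all (root (char_poly S)) rs.
    apply/negP => rsP.
    have rsu : uniq rs by rewrite map_inj_uniq ?iota_uniq.
    have := max_poly_roots (monic_neq0 (char_poly_monic S)) rsP rsu.
    by rewrite size_map size_iota size_char_poly ltnNge leqnSn.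
  by move=> /allPn[_ /mapP[s _ ->] ?]; exists s%:R.
set X0 := t *: (J * (1 - p)); have X0P : u_alg_fixing G J p X0 := u_alg_fixingZ t J_alg.
have [aX0 _ _] := X0P.
have zP := cayley_unitary hG X0P; have zE := adj_cayley hG aX0.
have zV := unitary_fixingV hG aJ zP.
have AP := unitary_fixingM hG zV BP.
have [zz zJ zp] := zP; have zz' := adjoint_inv zz.
set z := cayley X0 in zP zE zV AP zz zJ zp zz' *; set A := adj z * B in AP.
have pfix D : unitary_fixing G J p D -> p * D = p.
  move=> [DD _ Dp]; have aD : adj D * p = p by rewrite -{1}Dp mulrA DD mul1r.
  by have := congr1 adj aD; rewrite adjM// adjK// ap.
(* If [A V = - V] then [B V = - z V] and [B^* V = - z^* V], so that [V] would
   consist of eigenvectors of [B + B^*] for the excluded value [al t]. *)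
have A1u : A + 1 \is a GRing.unit.
  apply: unit_of_mul_eq0 => V; rewrite mulrDl mul1r => /eqP.
  rewrite addr_eq0 => /eqP AV.
  have pV : p * V = 0.
    have : p * V = - (p * V) by rewrite -{1}(pfix _ AP) -mulrA AV mulrN.
    by move=> /eqP; rewrite -addr_eq0 -mulr2n -scaler_nat scaler_eq0 pnatr_eq0 => /eqP.
  have BV : B * V = - (z * V).
    by rewrite -mulrN -AV /A !mulrA zz' mul1r.
  have zB : z * B = B * z.
    have X0B : GRing.comm B X0.
      rewrite /GRing.comm /X0 -scalerAl -scalerAr; congr (_ *: _).
      apply: commrM; first exact: BJ.
      by apply: commrB; [exact: commr1|rewrite /GRing.comm Bp (pfix _ BP)].
    apply/esym; rewrite /z /cayley; apply: commrB; last exact: commr1.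
    rewrite /GRing.comm -scalerAl -scalerAr; congr (_ *: _).
    by apply: commrV; apply: commrB; [exact: commr1|].
  have azB : adj B * adj z = adj z * adj B by rewrite -!adjM// zB.
  have aBV : adj B * V = - (adj z * V).
    have e : V = - (z * (adj B * V)).
      rewrite mulrA (_ : z * adj B = adj B * z); last first.
        by rewrite -[RHS]mulr1 -BB' -(mulrA (adj B)) (mulrA z) zB !mulrA BB mul1r.
      by rewrite -mulrA -mulrN -BV mulrA BB mul1r.
    by rewrite [in RHS]e mulrN opprK (mulrA (adj z)) zz mul1r.
  have aX0N : cayley (- X0) = cayley ((- t) *: (J * (1 - p))) by rewrite scaleNr.
  have SV : S * V = al t *: V.
    rewrite mulrDl BV aBV zE aX0N !cayley_J// sqrrN -opprD addrACA.
    rewrite mulrN mulNr [X in _ + X]addrC scaleNr addNr addr0 -scalerDl -scaleNr.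
    by congr (_ *: _); rewrite /al; ring.
  have : (S - (al t)%:M) * V = 0.
    by rewrite mulrBl SV [_%:M * V]mul_scalar_mx subrr.
  have : S - (al t)%:M \is a GRing.unit.
    move: tP; rewrite -eigenvalue_root_char /eigenvalue negbK /eigenspace.
    by rewrite kermx_eq0 row_free_unit.
  by move=> Su /(congr1 (fun Y => (S - (al t)%:M)^-1 * Y)); rewrite mulrA mulVr// mul1r mulr0.
have [X XP XA] := cayley_surj AP A1u.
by exists t, X; split=> //; rewrite XA /A mulrA zz' mul1r.
Qed.

End OrbitConnected.

(** * The orbit as a connected integral submanifold *)

Section OrbitManifold.
Variables (R : realType) (m : nat) (G J K1 p : 'M[R]_m.+1).
Hypothesis hG : is_metric G.
Hypothesis (JJ : J * J = -1) (aJ : adjoint G J = - J).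
Hypothesis (KK1 : K1 * K1 = -1) (aK1 : adjoint G K1 = - K1).
Hypothesis (ap : adjoint G p = p) (pp : p * p = p).
Hypothesis (Jp : GRing.comm J p) (K1p : GRing.comm K1 p).
Local Notation adj := (adjoint G).

Definition orbit K : set 'M[R]_m.+1 :=
  [set B * K * adj B | B in unitary_fixing G J p].

Lemma orbit_refl K : orbit K K.
Proof.
by exists 1; [exact: unitary_fixing1|rewrite mul1r adjoint1// mulr1].
Qed.

Lemma orbit_act K L B : unitary_fixing G J p B -> orbit K L ->
  orbit K (B * L * adj B).
Proof.
move=> BP [A AP <-]; exists (B * A); first exact: unitary_fixingM.
by rewrite adjM// !mulrA.
Qed.

Lemma orbit_sym K L : orbit K L -> orbit L K.
Proof.
move=> [B BP <-]; exists (adj B); first exact: unitary_fixingV.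
have [BB _ _] := BP.
by rewrite adjK// !mulrA BB mul1r -mulrA BB mulr1.
Qed.

Lemma orbit_trans K L N : orbit K L -> orbit L N -> orbit K N.
Proof. by move=> KL [B BP <-]; exact: orbit_act. Qed.

Definition orbit_pt K L (h : orbit K L) : set_type (orbit K) :=
  exist _ L (mem_set h).

(** The image of the segment from [0] to [X] under the one-dimensional chart. *)
Lemma orbit_path K (y : set_type (orbit K)) X (hX : u_alg_fixing G J p X) :
  exists2 y' : set_type (orbit K),
    set_val y' = cayley X * set_val y * adj (cayley X) &
    connected_component [set: set_type (orbit K)] y y'.
Proof.
pose C (i : 'I_1) := X; pose L := set_val y.
have CP i : u_alg_fixing G J p (C i) by [].
have cc : continuous (chart L C) := @continuous_chart _ _ _ _ L _ hG _ _ CP.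
pose v : 'rV[R]_1 := const_mx 1.
have hO x : orbit K (chart L C x).
  have [uP uE] := chart_unitary hG CP x.
  by rewrite /chart -uE; apply: orbit_act => //; exact: set_valP.
pose g (t : R) : set_type (orbit K) := orbit_pt (hO (t *: v)).
have gc : continuous g.
  apply: (@continuous_comp_initial _ _ _ (set_val : set_type (orbit K) -> _) g).
  move=> t; rewrite /continuous_at.
  have vt : (fun s : R => s *: v) @ nbhs t --> t *: v.
    exact: (@scalel_continuous _ _ v t).
  exact: (cvg_comp _ _ vt (cc (t *: v))).
have comboE t : combo C (t *: v) = t *: X.
  by rewrite comboZ /combo big_ord1 mxE scale1r.
have g0 : g 0 = y.
  apply: val_inj; rewrite /= /chart comboE scale0r oppr0 cayley0.
  by rewrite mul1r mulr1.
exists (g 1).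
  have [uP uE] := chart_unitary hG CP (1 *: v).
  rewrite comboE scale1r in uE.
  by rewrite [LHS]/(chart L C (1 *: v)) /chart comboE scale1r -uE.
apply: (@connected_component_max _ _ (g @` `[0, 1])) => //.
- by exists 0 => //=; rewrite in_itv /= lexx ler01.
- apply: connected_continuous_connected; first exact: segment_connected.
  exact: continuous_subspaceT.
- by exists 1 => //=; rewrite in_itv /= lexx ler01.
Qed.

Lemma orbit_connected K : connected [set: set_type (orbit K)].
Proof.
pose y0 := orbit_pt (orbit_refl K).
suff -> : [set: set_type (orbit K)] = connected_component [set: set_type (orbit K)] y0.
  exact: component_connected.
apply/seteqP; split=> // y _.
have [B BP yE] : orbit K (set_val y) by exact: set_valP.
have [t [X [XP BE]]] := unitary_cayley_decomposition hG JJ aJ ap pp Jp BP.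
have [y1 y1E c1] := orbit_path y0 XP.
have [y2 y2E c2] := orbit_path y1 (u_alg_fixingZ t (J_alg hG aJ ap pp Jp)).
suff -> : y = y2 by exact: connected_component_trans c1 c2.
apply: val_inj; rewrite [RHS]y2E [LHS](esym yE) y1E BE adjM// !mulrA.
by [].
Qed.

Lemma orbit_twistor K L : K * K = -1 -> adj K = - K -> GRing.comm K p ->
  orbit K L -> [/\ L * L = -1, adj L = - L & GRing.comm L p].
Proof.
move=> KK aK Kp [B BP <-]; have [BB BJ Bp] := BP; have BB' := adjoint_inv BB.
have [_ _ aBp] := unitary_fixingV hG aJ BP.
have pB : p * B = p by have := congr1 adj aBp; rewrite adjM// adjK// ap.
have paB : p * adj B = p by have := congr1 adj Bp; rewrite adjM// ap.
split.
- rewrite !mulrA -(mulrA (B * K)) BB mulr1 -(mulrA B) KK.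
  by rewrite mulrN1 mulNr BB'.
- by rewrite !adjM// adjK// aK !mulNr mulrN mulrA.
- rewrite /GRing.comm -(mulrA (B * K)) aBp -(mulrA B) Kp (mulrA B) Bp.
  by rewrite !mulrA pB -Kp -(mulrA K) paB.
Qed.

(** The orbit carries the topology induced by the ambient space. By homogeneity
    the frame at [K1] is transported to every point [L], where the chart centred
    at [L] applies; openness of the chart uses that the orbit lies in the level
    set of [L]. *)
Lemma orbit_integral_submanifold (X : set 'M[R]_m.+1)
    (D : 'M[R]_m.+1 -> set 'M[R]_m.+1) :
  orbit K1 `<=` X ->
  (forall L, orbit K1 L ->
     D L = [set Z * L - L * Z | Z in u_alg_fixing G J p]) ->
  connected_integral_submanifold X D (orbit K1).
Proof.
move=> OX DE; split=> //.
have [d [C frameC]] := bracket_basis G J K1 p.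
have charts (y : set_type (orbit K1)) : exists (c : 'rV[R]_d -> set_type (orbit K1))
    (r : R), [/\ 0 < r, c 0 = y, local_param set_val (ball 0 r) c &
      forall u, ball 0 r u ->
        [set 'D_v (set_val \o c) u | v in [set: 'rV[R]_d]] = D (set_val (c u))].
  pose L := set_val y; have hL : orbit K1 L by exact: set_valP.
  have [LL aL Lp] := orbit_twistor KK1 aK1 K1p hL.
  have [B BP LE] := hL.
  have := bracket_frame_conj hG aJ BP frameC; rewrite LE => frameL.
  have [c [r [[r0 c0] cO [cc cs] [cinj cD] csurj]]] :=
    local_chart hG JJ aJ LL aL ap Jp Lp frameL.
  have hc x : orbit K1 (c x).
    by have [A AP ->] := cO x; exact: orbit_act.
  pose c' x := orbit_pt (hc x).
  have vc : set_val \o c' = c by [].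
  have c'c : continuous c'.
    by apply: (@continuous_comp_initial _ _ _ (set_val : set_type (orbit K1) -> _) c').
  exists c', r; split=> //.
  - by apply: val_inj; rewrite /= c0.
  - split.
    + exact: ball_open.
    + split; last by move=> x _; exact: c'c.
      move=> x y'; rewrite !inE => xr yr /(congr1 set_val) /= e.
      exact: cinj.
    + move=> O Oopen Or; rewrite openE => _ [x Ox <-]; rewrite /interior.
      have nb := @initial_continuous _ _ (set_val : set_type (orbit K1) -> _)
        (c' x) _ (csurj O x Oopen Or Ox).
      apply: (@filterS _ _ (nbhs_filter (c' x)) _ _ _ nb) => z /= zP.
      have zlev : level_set G J L p (set_val z).
        have [A AP <-] : orbit L (set_val z).
          by apply: (orbit_trans (orbit_sym hL)); exact: set_valP.
        exact: unitary_conj_level.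
      have [u Ou uE] := zP zlev.
      by exists u => //; apply: val_inj.
    + by rewrite vc.
    + by rewrite vc => u v ur; have [Dinj _] := cD u ur; exact: Dinj.
  - move=> u ur; rewrite vc DE; last exact: hc.
    by have [_] := cD u ur; exact.
have vi : injective (set_val : set_type (orbit K1) -> 'M[R]_m.+1) by exact: val_inj.
exists d, (set_type (orbit K1)), set_val; split=> //.
- apply/seteqP; split=> L /=; first by move=> [y _ <-]; exact: set_valP.
  by move=> hL; exists (orbit_pt hL).
- exact: orbit_connected.
move=> y; have [c [r [r0 c0 cP cD]]] := charts y.
by exists (ball 0 r), c; split=> //; exists 0 => //; exact: ballxx.
Qed.

End OrbitManifold.

(** * The kernel projection along an orbit *)

Section Leaves.
Variables (R : realType) (m : nat) (G J : 'M[R]_m.+1).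
Hypothesis hG : is_metric G.
Hypothesis hJ : twistor G J.
Variables (k : nat) (a : nat -> 'M[R]_m.+1 -> R).
Hypothesis ha_poly : forall i, (i <= k)%N ->
  exists P : mpoly.mpoly m.+1 R, forall K, twistor G K ->
    a i K = mpoly.meval (fun j => f_coef J j K) P.
Variable S : 'M[R]_m.+1 -> 'M[R]_m.+1.
Hypothesis hS : [\/ S = (fun K => 1%:M), S = (fun K => J + K),
                    S = (fun K => J - K) | S = (fun K => comm J K)].
Local Notation adj := (adjoint G).
Local Notation QS K := (Qsec J k a K *m S K).
Implicit Types (B K L p : 'M[R]_m.+1).

Let JJ : J * J = -1. Proof. by have /(twistorP hG)[] := hJ. Qed.
Let aJ : adj J = - J. Proof. by have /(twistorP hG)[] := hJ. Qed.

(** Conjugate arguments give [{J, K}] and [{J, L}] the same characteristic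
    polynomial, hence the same values of the [f_j]. *)
Lemma coefs_intertwined K L B : twistor G K -> twistor G L ->
  B \is a GRing.unit -> GRing.comm B J -> B * K = L * B ->
  forall i, (i <= k)%N -> a i K = a i L.
Proof.
move=> hK hL Bu BJ BK i ik; have [P aE] := ha_poly ik.
rewrite (aE _ hK) (aE _ hL); congr (mpoly.meval _ P).
apply/funext => j; rewrite /f_coef.
by rewrite (char_poly_intertwined Bu (acomm_intertwined BJ BK)).
Qed.

Lemma QSE K b : (forall i, (i <= k)%N -> b i = a i K) -> QS K = QS_const J S k b K.
Proof.
move=> bE; rewrite /Qsec /QS_const; congr (_ *m _).
by apply: eq_bigr => i _; rewrite bE// -ltnS.
Qed.

Lemma QS_conj K L B : twistor G K -> twistor G L ->
  B \is a GRing.unit -> GRing.comm B J -> B * K = L * B ->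
  B * QS K = QS L * B.
Proof.
move=> hK hL Bu BJ BK; rewrite (QSE (b := fun i => a i K))//.
rewrite (QSE (b := fun i => a i K)); first exact: QS_intertwined.
by move=> i; exact: coefs_intertwined hK hL Bu BJ BK i.
Qed.

(** A symmetric idempotent is an orthogonal projection; that it commutes with
    [J] and [K] expresses the invariance of the splitting. *)
Definition kernel_proj K p :=
  [/\ adj p = p, p * p = p, GRing.comm J p, GRing.comm K p &
      ker_space (QS K) = [set v | p *m v = v] /\
      im_space (QS K) = [set v | p *m v = 0]].

Lemma kernel_poly_proj K q : twistor G K -> kernel_poly (QS K) q ->
  kernel_proj K (horner_mx (QS K) q).
Proof.
move=> hK; have /(twistorP hG)[KK aK] := hK.
rewrite (QSE (b := fun i => a i K))//.
have [s /(_ (fun i => a i K) K KK aK) sP] := QS_symmetry hG JJ aJ hS k.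
have [[X QJ] [Y QK]] := QS_exchange JJ hS k (fun i => a i K) KK.
move=> qP; split.
- exact: (adj_kernel_proj hG sP qP).
- exact: (kernel_proj_idem qP).
- exact: (kernel_proj_stable hG sP qP aJ QJ).
- exact: (kernel_proj_stable hG sP qP aK QK).
- by split; [exact: ker_spaceE|exact: im_spaceE].
Qed.

Lemma QS_kernel_poly K : twistor G K -> exists q, kernel_poly (QS K) q.
Proof.
move=> hK; have /(twistorP hG)[KK aK] := hK.
rewrite (QSE (b := fun i => a i K))//.
have [s /(_ (fun i => a i K) K KK aK) sP] := QS_symmetry hG JJ aJ hS k.
exact: (kernel_poly_exists hG sP).
Qed.

Lemma kernel_proj_exists K : twistor G K -> exists p, kernel_proj K p.
Proof.
move=> hK; have [q qP] := QS_kernel_poly hK.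
by exists (horner_mx (QS K) q); exact: kernel_poly_proj.
Qed.

Lemma kernel_poly_intertwined P P' B q :
  B \is a GRing.unit -> B * P = P' * B -> kernel_poly P q -> kernel_poly P' q.
Proof.
move=> Bu BP [qr q0]; split=> //; apply: (mulIr Bu).
by rewrite -(horner_mx_intertwined _ BP) q0 mulr0 mul0r.
Qed.

(** Conjugation by [B] carries [QS K] to [QS L] and [p] to [B p B^* = p]. *)
Lemma kernel_proj_conj K L B p : twistor G K -> twistor G L ->
  kernel_proj K p -> unitary_fixing G J p B -> L = B * K * adj B ->
  kernel_proj L p.
Proof.
move=> hK hL [ap pp Jp Kp [kerE imE]] BP LE; have [BB BJ Bp] := BP.
have BB' := adjoint_inv BB.
have [/(twistorP hG)[KK aK] /(twistorP hG)[LL aL]] := (hK, hL).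
have [_ _ aBp] := unitary_fixingV hG aJ BP.
have pB : p * B = p by have := congr1 adj aBp; rewrite adjM// adjK// ap.
have Bu : B \is a GRing.unit by apply/unitrP; exists (adj B).
have BK : B * K = L * B by rewrite LE -mulrA BB mulr1.
have QB := QS_conj hK hL Bu BJ BK.
have BKB (v : 'cV[R]_m.+1) : adj B *m (B *m v) = v.
  by rewrite mulmxA [adj B *m B]BB mul1mx.
have [_ _ Lp] : [/\ L * L = -1, adj L = - L & GRing.comm L p].
  by apply: (orbit_twistor hG aJ ap KK aK Kp); exists B.
have kerK (v : 'cV[R]_m.+1) : (QS K *m v = 0) <-> (p *m v = v).
  by have := congr1 (fun E : set _ => E v) kerE; rewrite /ker_space /= => ->.
have imK (v : 'cV[R]_m.+1) : im_space (QS K) v <-> (p *m v = 0).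
  by have := congr1 (fun E : set _ => E v) imE; rewrite /= => ->.
have QLE : QS L = B *m (QS K *m adj B).
  by rewrite mulmxA [B *m QS K]QB -[_ *m B *m _]/(QS L * B * adj B) -mulrA BB' mulr1.
split=> //; move: QLE kerK imK {QB kerE imE}.
move: (QS K) (QS L) => P P' QLE kerK imK.
split; apply/seteqP; split=> v /=.
- rewrite /ker_space /= QLE -!mulmxA => h.
  have /kerK h2 : P *m (adj B *m v) = 0.
    by rewrite -[LHS]mul1mx -[1%:M]BB -mulmxA h mulmx0.
  have : B *m (p *m (adj B *m v)) = B *m (adj B *m v) by rewrite h2.
  rewrite !mulmxA [B *m adj B]BB' [B *m p]Bp mul1mx => e.
  rewrite -[RHS]e; congr (_ *m v).
  by have := congr1 adj Bp; rewrite adjM// ap.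
- move=> pv; rewrite /ker_space /= QLE -!mulmxA.
  have -> : adj B *m v = v by rewrite -pv mulmxA [adj B *m p]aBp.
  by have /kerK -> := pv; rewrite mulmx0.
- move=> [w _ <-]; rewrite QLE -!mulmxA mulmxA [p *m B]pB.
  by apply/imK; exists (adj B *m w).
- move=> pv; have /imK[w _ wE] : p *m (adj B *m v) = 0.
    rewrite mulmxA; have -> : p *m adj B = p.
      by have := congr1 adj Bp; rewrite adjM// ap.
    by [].
  exists (B *m w) => //; rewrite QLE -!mulmxA BKB wE mulmxA [B *m adj B]BB'.
  by rewrite mul1mx.
Qed.

Lemma leafQS_orbit K p : twistor G K -> kernel_proj K p ->
  leafQS G J (fun K => QS K) K = orbit G J p K.
Proof.
move=> hK [ap pp Jp Kp [kerE imE]]; have /(twistorP hG)[KK aK] := hK.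
exact: (leafQSE hG ap pp Jp Kp kerE imE).
Qed.

Lemma distributionQS_alg K p : twistor G K -> kernel_proj K p ->
  distributionQS G J (fun K => QS K) K =
  [set Z * K - K * Z | Z in u_alg_fixing G J p].
Proof.
move=> hK [ap pp Jp Kp [kerE imE]]; have /(twistorP hG)[KK aK] := hK.
exact: (distributionQSE J hG KK aK ap pp kerE imE (QS := fun K => QS K)).
Qed.

Lemma orbit_in_twistor K L p : twistor G K -> kernel_proj K p ->
  orbit G J p K L -> twistor G L /\ kernel_proj L p.
Proof.
move=> hK Kp KL; have [ap _ _ cKp _] := Kp.
have /(twistorP hG)[KK aK] := hK.
have [LL aL _] := orbit_twistor hG aJ ap KK aK cKp KL.
have hL : twistor G L by apply/(twistorP hG).
split=> //; have [B BP LE] := KL.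
exact: (kernel_proj_conj hK hL Kp BP (esym LE)).
Qed.

End Leaves.

(** * Curves tangent to the distribution *)

Section Flow.
Variables (R : realType) (m : nat) (C : R -> 'M[R]_m.+1).
Local Notation I01 := (`[0 : R, 1]%R).
Implicit Types (F : R -> 'M[R]_m.+1) (A : 'M[R]_m.+1).

(** The Lax equation. Its solutions form an algebra, since the bracket with [C]
    is a derivation, and their traces are constant. *)
Definition flows F :=
  forall t : R, t \in I01 -> is_derive t 1 F (C t * F t - F t * C t).

Lemma flows_cst A : (forall t, t \in I01 -> GRing.comm (C t) A) -> flows (fun=> A).
Proof. by move=> CA t /CA ->; rewrite subrr; exact: is_derive_cst. Qed.

Lemma flowsD F (F' : R -> 'M[R]_m.+1) : flows F -> flows F' -> flows (fun t => F t + F' t).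
Proof.
move=> hF hF' t ht; rewrite mulrDr mulrDl opprD addrACA.
by have d1 := hF t ht; have d2 := hF' t ht; exact: is_deriveD.
Qed.

Lemma flowsM F (F' : R -> 'M[R]_m.+1) : flows F -> flows F' -> flows (fun t => F t * F' t).
Proof.
move=> hF hF' t ht; have := is_derive_mulr (hF t ht) (hF' t ht).
by rewrite mulrBl mulrBr !mulrA subrKA.
Qed.

Lemma flows1 : flows (fun=> 1).
Proof. by apply: flows_cst => t _; exact: commr1. Qed.

Lemma flowsZ (s : R) F : flows F -> flows (fun t => s *: F t).
Proof.
move=> hF t ht; have d1 := hF t ht.
rewrite -scalerAr -scalerAl -scalerBr; exact: is_deriveZ.
Qed.

Lemma flowsX F k : flows F -> flows (fun t => F t ^+ k).
Proof.
move=> hF; elim: k => [|k IHk].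
  by under eq_fun do rewrite expr0; exact: flows1.
by under eq_fun do rewrite exprS; exact: flowsM.
Qed.

Lemma flows_sum n (F : 'I_n -> R -> 'M[R]_m.+1) :
  (forall i, flows (F i)) -> flows (fun t => \sum_i F i t).
Proof.
move=> hF; elim: n F hF => [|n IHn] F hF.
  by under eq_fun do rewrite big_ord0; apply: flows_cst => t _; exact: commr0.
under eq_fun do rewrite big_ord_recl; apply: flowsD => //.
by apply: IHn => i.
Qed.

Lemma flows_horner F q : flows F -> flows (fun t => horner_mx (F t) q).
Proof.
move=> hF; elim/poly_ind: q => [|q c IHq].
  by under eq_fun do rewrite rmorph0; apply: flows_cst => t _; exact: commr0.
under eq_fun do rewrite rmorphD rmorphM /= horner_mx_X horner_mx_C.
apply: flowsD; first exact: flowsM.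
by apply: flows_cst => t _; rewrite /GRing.comm [LHS]scalar_mxC.
Qed.

Lemma flows_mxtrace F : flows F -> forall t, t \in I01 -> \tr (F t) = \tr (F 0).
Proof.
move=> hF; apply: is_derive0_cst => t ht; have := is_derive_mxtrace (hF t ht).
by rewrite linearB /= [\tr (C t * F t)]mxtrace_mulC subrr.
Qed.

Lemma flows_eq0 F : flows F -> (forall t, t \in I01 -> C t * F t - F t * C t = 0) ->
  forall t, t \in I01 -> F t = F 0.
Proof.
move=> hF CF t ht; apply/matrixP => i j.
apply: (@is_derive0_cst _ (fun s => F s i j)) => // s hs.
have := is_derive_coord i j (hF s hs).
by rewrite CF// mxE.
Qed.

End Flow.

Section TangentCurves.
Variables (R : realType) (m : nat) (G J : 'M[R]_m.+1).
Hypothesis hG : is_metric G.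
Hypothesis hJ : twistor G J.
Variables (k : nat) (a : nat -> 'M[R]_m.+1 -> R).
Hypothesis ha_poly : forall i, (i <= k)%N ->
  exists P : mpoly.mpoly m.+1 R, forall K, twistor G K ->
    a i K = mpoly.meval (fun j => f_coef J j K) P.
Variable S : 'M[R]_m.+1 -> 'M[R]_m.+1.
Hypothesis hS : [\/ S = (fun K => 1%:M), S = (fun K => J + K),
                    S = (fun K => J - K) | S = (fun K => comm J K)].
Local Notation adj := (adjoint G).
Local Notation QS K := (Qsec J k a K *m S K).
Local Notation I01 := (`[0 : R, 1]%R).
Implicit Types (B K L p : 'M[R]_m.+1).

Let JJ : J * J = -1. Proof. by have /(twistorP hG)[] := hJ. Qed.
Let aJ : adj J = - J. Proof. by have /(twistorP hG)[] := hJ. Qed.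

Variables (K : 'M[R]_m.+1) (q e : {poly R}) (Q : 'M[R]_m.+1).
Hypothesis hK : twistor G K.
Hypothesis qP : kernel_poly (QS K) q.
Hypothesis QGQ : Q^T *m G *m Q = 1%:M.
Local Notation p := (horner_mx (QS K) q).

(** Along a curve tangent to the distribution the spectrum of [J gamma] does not
    change, so that [gamma] remains conjugate to its starting point. Hence the
    same polynomial [q] gives the projection onto the kernel of [QS], and this
    projection has velocity [[C, p] = 0]. *)
Lemma tangent_curve_level (gam : R -> 'M[R]_m.+1) :
  gam 0 = K -> (forall t, t \in I01 -> twistor G (gam t)) ->
  (forall t, t \in I01 -> near_one Q (intertwiner J K e K (gam t))) ->
  (forall t, t \in I01 -> exists2 X,
     distributionQS G J (fun K => QS K) (gam t) X & is_derive t 1 gam X) ->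
  level_set G J K p (gam 1).
Proof.
move=> gam0 gamT gam_near gamD.
have /choice[C CP] : forall t, exists Ct, t \in I01 ->
    [/\ adj Ct = - Ct, GRing.comm Ct J,
        forall v, ker_space (QS (gam t)) v -> Ct *m v = 0 &
        is_derive t 1 gam (Ct * gam t - gam t * Ct)].
  move=> t; have [ht|_] := boolP (t \in I01); last by exists 0.
  have [X [_ [Ct [[/(so_algP hG) aC CJ] Cker _ XE]]] gX] := gamD t ht.
  exists Ct => _; split=> //; first exact: subr0_eq CJ.
  by rewrite -[_ - _]/(comm Ct (gam t)) -XE.
have I0 : (0 : R) \in I01 by rewrite in_itv /= lexx ler01.
have I1 : (1 : R) \in I01 by rewrite in_itv /= lexx ler01.
(* [J], being constant and commuting with [C], is a solution, and [gamma] is one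
   by tangency. *)
have flJ : flows C (fun=> J) by apply: flows_cst => t /CP[].
have flg : flows C gam by move=> t /CP[].
have flJg : flows C (fun t => J * gam t) by exact: flowsM.
have flgJ : flows C (fun t => gam t * J) by exact: flowsM.
pose f := mxminpoly (J * K).
(* The squared norm of [f (J gamma)] is the trace of a solution, and vanishes at
   the start. *)
have iso t : t \in I01 -> isospectral J K (gam t).
  move=> ht; apply: (mxtrace_adjM_eq0 hG).
  have aE s : s \in I01 -> adj (horner_mx (J * gam s) f) = horner_mx (gam s * J) f.
    move=> hs; have /(twistorP hG)[_ ag] := gamT s hs.
    by rewrite adj_horner// adjM// aJ ag mulrNN.
  have tr := flows_mxtrace (flowsM (flows_horner f flgJ) (flows_horner f flJg)) ht.
  rewrite -[horner_mx (J * gam t) _]/(horner_mx (J * gam t) f) (aE t ht) tr gam0.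
  by rewrite [horner_mx (J * K) f]mx_root_minpoly mulr0 linear0.
have /(twistorP hG)[KK aK] := hK.
have isoK := isospectral_refl J K.
pose b i := a i K.
(* [QS] with the coefficients frozen at [K] is a solution, and so is [q] of it.
   By conjugacy it is the actual value of [QS] along the curve. *)
have flM : flows C (fun t => acomm J (gam t)) by exact: flowsD.
have flS : flows C (fun t => S (gam t)).
  case: hS => ->.
  - exact: flows1.
  - exact: flowsD.
  - under eq_fun do rewrite -scaleN1r.
    by apply: flowsD => //; exact: flowsZ.
  - rewrite /comm; under eq_fun do rewrite -scaleN1r.
    by apply: flowsD => //; exact: flowsZ.
have flQ : flows C (fun t => QS_const J S k b (gam t)).
  rewrite /QS_const; apply: flowsM => //; apply: flows_sum => i.
  by apply: flowsZ; exact: flowsX.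
pose pt t := horner_mx (QS_const J S k b (gam t)) q.
have flp : flows C pt by exact: flows_horner.
have ptP t : t \in I01 -> kernel_proj G J k a S (gam t) (pt t).
  move=> ht; have hg := gamT t ht; have /(twistorP hG)[gg ag] := hg.
  set B := intertwiner J K e K (gam t).
  have Bu : B \is a GRing.unit by apply: (near_one_unit hG QGQ); exact: gam_near.
  have BJ : GRing.comm B J by apply/esym; exact: intertwinerJ.
  have BK : B * K = gam t * B by apply/esym; apply: intertwinerP => //; exact: iso.
  have -> : pt t = horner_mx (QS (gam t)) q.
    rewrite /pt -(@QSE _ _ J k a S (gam t) b)// => i ik.
    exact: (coefs_intertwined ha_poly hK hg Bu BJ BK).
  apply: kernel_poly_proj => //.
  exact: (kernel_poly_intertwined Bu (QS_conj ha_poly hS hK hg Bu BJ BK) qP).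
have p0 : pt 0 = p by rewrite /pt gam0 -(@QSE _ _ J k a S K b).
have Cp t : t \in I01 -> C t * pt t = 0 /\ pt t * C t = 0.
  move=> ht; have [aC _ Cker _] := CP t ht; have [ap pp _ _ [kerE _]] := ptP t ht.
  have Cp0 : C t * pt t = 0.
    apply: (mx_eqP hG) => v; rewrite mul0mx -mulmxA; apply: Cker.
    by rewrite kerE /= mulmxA [pt t *m pt t]pp.
  split=> //; have := congr1 adj Cp0; rewrite adjM// ap aC mulrN adjoint0.
  by move=> /eqP; rewrite oppr_eq0 => /eqP.
have p1 : pt 1 = p.
  rewrite -p0; apply: (flows_eq0 flp) => // t ht.
  by have [-> ->] := Cp t ht; rewrite subrr.
have g1 : gam 1 * pt 1 = K * p.
  rewrite -p0 -gam0; apply: (flows_eq0 (flowsM flg flp)) => // t ht.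
  have [Cp0 pC0] := Cp t ht; have [_ _ _ gp _] := ptP t ht.
  by rewrite -[gam t * _ * C t]mulrA pC0 mulr0 subr0 gp mulrA Cp0 mul0r.
have /(twistorP hG)[gg ag] := gamT 1 I1.
by split=> //; [exact: iso|rewrite -p1 g1 p1].
Qed.

End TangentCurves.

(** * Maximality of the leaf *)

Section MaximalLeaves.
Variables (R : realType) (m : nat) (G J : 'M[R]_m.+1).
Hypothesis hG : is_metric G.
Hypothesis hJ : twistor G J.
Variables (k : nat) (a : nat -> 'M[R]_m.+1 -> R).
Hypothesis ha_poly : forall i, (i <= k)%N ->
  exists P : mpoly.mpoly m.+1 R, forall K, twistor G K ->
    a i K = mpoly.meval (fun j => f_coef J j K) P.
Variable S : 'M[R]_m.+1 -> 'M[R]_m.+1.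
Hypothesis hS : [\/ S = (fun K => 1%:M), S = (fun K => J + K),
                    S = (fun K => J - K) | S = (fun K => comm J K)].
Local Notation adj := (adjoint G).
Local Notation QS := (fun K => Qsec J k a K *m S K).
Local Notation proj := (kernel_proj G J k a S).
Local Notation D := (distributionQS G J QS).
Implicit Types (B K L p : 'M[R]_m.+1).

Let JJ : J * J = -1. Proof. by have /(twistorP hG)[] := hJ. Qed.
Let aJ : adj J = - J. Proof. by have /(twistorP hG)[] := hJ. Qed.

Lemma leafQS_submanifold K : twistor G K ->
  connected_integral_submanifold (twistor G) D (leafQS G J QS K) /\
  leafQS G J QS K K.
Proof.
move=> hK; have [p pK] := kernel_proj_exists hG hJ k a hS hK.
have [ap pp Jp Kp _] := pK; have /(twistorP hG)[KK aK] := hK.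
rewrite (leafQS_orbit hG hK pK); split; last exact: orbit_refl.
apply: orbit_integral_submanifold => //.
  by move=> L /(orbit_in_twistor hG hJ ha_poly hS hK pK)[].
move=> L /(orbit_in_twistor hG hJ ha_poly hS hK pK)[hL pL].
exact: (distributionQS_alg hG hL pL).
Qed.

Lemma leafQS_sym K L : twistor G K -> leafQS G J QS K L -> leafQS G J QS L K.
Proof.
move=> hK; have [p pK] := kernel_proj_exists hG hJ k a hS hK.
rewrite (leafQS_orbit hG hK pK) => KL.
have [hL pL] := orbit_in_twistor hG hJ ha_poly hS hK pK KL.
by rewrite (leafQS_orbit hG hL pL); exact: orbit_sym.
Qed.

Lemma leafQS_trans K L N : twistor G K ->
  leafQS G J QS K L -> leafQS G J QS L N -> leafQS G J QS K N.
Proof.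
move=> hK; have [p pK] := kernel_proj_exists hG hJ k a hS hK.
rewrite (leafQS_orbit hG hK pK) => KL.
have [hL pL] := orbit_in_twistor hG hJ ha_poly hS hK pK KL.
by rewrite (leafQS_orbit hG hL pL); exact: (orbit_trans hG KL).
Qed.

(** A point of an integral submanifold is joined to the points nearby by curves
    that are straight in a local parametrization. *)
Lemma integral_submanifold_local (d : nat) (M : topologicalType)
    (iota : M -> 'M[R]_m.+1) (U : set 'rV[R]_d) (c : 'rV[R]_d -> M) u0 :
  (forall x, twistor G (iota x)) -> local_param iota U c -> U u0 ->
  (forall u, U u ->
     [set 'D_v (iota \o c) u | v in [set: 'rV[R]_d]] = D (iota (c u))) ->
  exists W : set M, [/\ open W, W (c u0) &
    forall y, W y -> leafQS G J QS (iota (c u0)) (iota y)].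
Proof.
move=> MT [Uopen _ copen csmooth _] Uu0 cD.
set K := iota (c u0); have hK : twistor G K by exact: MT.
have /(twistorP hG)[KK aK] := hK.
have [q qP] := QS_kernel_poly hG hJ k a hS hK.
have pK := kernel_poly_proj hG hJ hS hK qP.
have [ap pp Jp Kp _] := pK.
have [e eP] := isospectral_bezout hG JJ aJ KK aK.
have [Q QGQ] := metric_frame hG.
have [s s0 near_twine] := near_one_intertwiner JJ eP QGQ.
have [d' [C frameC]] := bracket_basis G J K (horner_mx (QS K) q).
have [c' [r [[r0 c'0] c'O _ _ c'surj]]] := local_chart hG JJ aJ KK aK ap Jp Kp frameC.
have nbK : nbhs K [set L | level_set G J K (horner_mx (QS K) q) L ->
    exists2 y, ball 0 r y & c' y = L].
  have := c'surj (ball 0 r) 0 (@ball_open _ _ _ _) (@subset_refl _ _) (ballxx _ r0).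
  by rewrite c'0.
pose F := iota \o c.
have Fc : {for u0, continuous F} by have := csmooth 0%N; apply; rewrite inE.
have FD u v : U u -> derivable F u v.
  by move=> Uu; have [_ /(_ v)[+ _]] := csmooth 1%N; apply.
have [r2 /= r20 r2P] : exists2 r2 : R, 0 < r2 & ball u0 r2 `<=`
    [set u | [/\ U u, ball K s (F u) &
     level_set G J K (horner_mx (QS K) q) (F u) ->
       exists2 y, ball 0 r y & c' y = F u]].
  have n1 : nbhs u0 U by exact: open_nbhs_nbhs.
  have n2 := Fc _ (nbhsx_ballx K _ s0).
  have n3 := Fc _ nbK.
  have FF := nbhs_filter u0.
  have n := @filterI _ _ FF _ _ n1 (@filterI _ _ FF _ _ n2 n3).
  have [r2 /= r20 r2P] := (nbhs_ballP _ _).1 n.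
  by exists r2 => // u /r2P[? []].
exists (c @` ball u0 r2); split.
- by apply: copen; [exact: ball_open|move=> u /r2P[]].
- by exists u0 => //; exact: ballxx.
move=> _ [u ur <-]; rewrite (leafQS_orbit hG hK pK).
pose gam (t : R) := F (t *: (u - u0) + u0).
have seg (t : R) : t \in `[0 : R, 1]%R -> ball u0 r2 (t *: (u - u0) + u0).
  rewrite in_itv /= => /andP[t0 t1]; rewrite -ball_normE /ball_ /=.
  rewrite opprD addrCA subrr addr0 normrN normrZ ger0_norm//.
  move: ur; rewrite -ball_normE /ball_ /= distrC; apply: le_lt_trans.
  by rewrite ler_piMl.
have gam1 : gam 1 = F u by rewrite /gam scale1r subrK.
have gam0 : gam 0 = K by rewrite /gam scale0r add0r.
have lev : level_set G J K (horner_mx (QS K) q) (gam 1).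
  apply: (tangent_curve_level hG hJ ha_poly hS hK qP QGQ gam0).
  - by move=> t _; exact: MT.
  - move=> t /seg /r2P[_ bs _]; apply: near_twine => //; exact: ballxx.
  - move=> t /seg /r2P[Ut _ _]; exists ('D_(u - u0) F (t *: (u - u0) + u0)).
      by rewrite -cD//; exists (u - u0).
    by apply: is_derive_along_line; apply/derivableP; exact: FD.
rewrite gam1 in lev; have [_ _ /(_ lev)[y _ yE]] := r2P u ur.
rewrite -[iota (c u)]/(F u) -yE.
by have [B BP ->] := c'O y; exists B.
Qed.

(** The points of [N] on the leaf form an open set, and so do the others,
    because leaves are either equal or disjoint. *)
Lemma leafQS_maximal K N : twistor G K ->
  connected_integral_submanifold (twistor G) D N -> N K ->
  N `<=` leafQS G J QS K.
Proof.
move=> hK [NT [d [M [iota [iota_inj iotaN Mconn charts]]]]] NK.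
have MT x : twistor G (iota x) by apply: NT; rewrite -iotaN; exists x.
have local x : exists W : set M, [/\ open W, W x &
    forall y, W y -> leafQS G J QS (iota x) (iota y)].
  have [U [c [cP [u0 Uu0 <-] cD]]] := charts x.
  exact: (integral_submanifold_local MT cP Uu0 cD).
pose A := [set x : M | leafQS G J QS K (iota x)].
have Aopen : open A.
  rewrite openE => x Ax; have [W [Wopen Wx WP]] := local x.
  apply: (@filterS _ _ (nbhs_filter x) W); last exact: open_nbhs_nbhs.
  by move=> y /WP; exact: leafQS_trans.
have ACopen : open (~` A).
  rewrite openE => x Ax; have [W [Wopen Wx WP]] := local x.
  apply: (@filterS _ _ (nbhs_filter x) W); last exact: open_nbhs_nbhs.
  move=> y /WP xy Ay; apply: Ax; apply: (leafQS_trans hK Ay).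
  exact: leafQS_sym.
have AT : A = [set: M].
  have [x0 _ x0K] : exists2 x, [set: M] x & iota x = K.
    by move: NK; rewrite -iotaN.
  apply: Mconn.
  - by exists x0; rewrite /A /= x0K; have [] := leafQS_submanifold hK.
  - by exists A => //; rewrite setTI.
  - by exists A; [rewrite -[A]setCK; exact: open_closedC|rewrite setTI].
by rewrite -iotaN => _ [x _ <-]; have : A x by rewrite AT.
Qed.

Lemma leafQS_is_leaf K : twistor G K ->
  is_leaf (twistor G) D K (leafQS G J QS K).
Proof.
move=> hK; have [sub KK] := leafQS_submanifold hK; split=> // N.
exact: leafQS_maximal.
Qed.

Lemma QS_splitting K : twistor G K ->
  [/\ orthogonal_splitting G (ker_space (QS K)) (im_space (QS K)),
      stable J (ker_space (QS K)) /\ stable J (im_space (QS K)) &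
      stable K (ker_space (QS K)) /\ stable K (im_space (QS K))].
Proof.
move=> hK; have [p [ap pp Jp Kp [kerE imE]]] :=
  kernel_proj_exists hG hJ k a hS hK.
split.
- exact: (kernel_splitting hG ap pp kerE imE).
- exact: (kernel_stable kerE imE Jp).
- exact: (kernel_stable kerE imE Kp).
Qed.

End MaximalLeaves.

Theorem theorem7p13 (R : realType) (n : nat) (hn : (4 <= 2 * n)%N)
  (G : 'M[R]_(2 * n)) (hG : is_metric G)
  (J : 'M[R]_(2 * n)) (hJ : twistor G J)
  (k : nat) (a : nat -> 'M[R]_(2 * n) -> R)
  (ha_smooth : forall i, (i <= k)%N -> smooth_function (twistor G) (a i))
  (ha_poly : forall i, (i <= k)%N ->
     exists p : mpoly.mpoly (2 * n) R, forall K, twistor G K ->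
       a i K = mpoly.meval (fun j => f_coef J j K) p)
  (S : 'M[R]_(2 * n) -> 'M[R]_(2 * n))
  (hS : [\/ S = (fun K => 1%:M), S = (fun K => J + K),
            S = (fun K => J - K) | S = (fun K => comm J K)])
  (QS : 'M[R]_(2 * n) -> 'M[R]_(2 * n))
  (hQS : QS = (fun K => Qsec J k a K *m S K)) :
  integrable_distribution (twistor G) (distributionQS G J QS) /\
  forall K, twistor G K ->
    [/\ orthogonal_splitting G (ker_space (QS K)) (im_space (QS K)),
        stable J (ker_space (QS K)) /\ stable J (im_space (QS K)),
        stable K (ker_space (QS K)) /\ stable K (im_space (QS K)) &
        is_leaf (twistor G) (distributionQS G J QS) K (leafQS G J QS K)].
Proof.
move: hn G hG J hJ k a ha_smooth ha_poly S hS QS hQS.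
move: (2 * n)%N => [//|m] _ G hG J hJ k a _ ha_poly S hS QS ->.
split=> K hK.
  have [sub KK] := leafQS_submanifold hG hJ ha_poly hS hK.
  by exists (leafQS G J (fun K => Qsec J k a K *m S K) K).
have [split stJ stK] := QS_splitting hG hJ k a hS hK.
by split=> //; exact: leafQS_is_leaf.
Qed.
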